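(* Let $\mathcal{FV}$, $\mathcal{PV}$, $\mathcal{SV}$, $\mathcal{SD}$, $\mathcal{FFV}$ and $\mathcal{HT}$ denote, respectively, the collections of diffeological vector spaces that are fine; that are projective; whose smooth linear functionals separate points; whose smooth functionals separate points; all of whose finite-dimensional subspaces are fine; and whose $D$-topology is Hausdorff. Then $$\mathcal{FV} \subsetneq \mathcal{PV} \subsetneq \mathcal{SV} \subseteq \mathcal{SD} \subsetneq \mathcal{FFV} \quad\text{and}\quad \mathcal{SD} \subsetneq \mathcal{HT}.$$ Moreover, neither of $\mathcal{HT}$ and $\mathcal{FFV}$ contains the other.
   Context: A diffeological space is a set $X$ together with a specified set of functions $U\to X$ (called plots) for each open set $U\subseteq\mathbb{R}^n$ and each $n\in\mathbb{N}$, such that: (1) every constant function $U\to X$ is a plot; (2) if $U\to X$ is a plot and $V\to U$ is smooth ($V$ open in some $\mathbb{R}^m$), then the composite $V\to U\to X$ is a plot; (3) if $U=\bigcup_i U_i$ is an open cover and $U\to X$ is a function each of whose restrictions $U_i\to X$ is a plot, then $U\to X$ is a plot. A function $f:X\to Y$ between diffeological spaces is smooth if $f\circ p$ is a plot of $Y$ for every plot $p$ of $X$. $\mathbb{R}^n$ carries the standard diffeology (plots are the usual smooth maps). Subsets carry the sub-diffeology (plots are the functions that are plots of the ambient space) and products carry the product diffeology (plots are the functions all of whose components are plots). A subset $A\subseteq X$ is $D$-open if $p^{-1}(A)$ is open for every plot $p$ of $X$; the $D$-open sets form the $D$-topology. A subduction is a map $f:X\to Y$ such that the plots of $Y$ are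 exactly the functions $U\to Y$ that locally lift through $f$ to plots of $X$ (in particular $f$ is smooth and surjective). A diffeological vector space is a real vector space $V$ with a diffeology such that addition $V\times V\to V$ and scalar multiplication $\mathbb{R}\times V\to V$ are smooth. A subspace means a linear subspace with the sub-diffeology. $V$ is fine if its diffeology is the smallest (fewest plots) diffeology making the vector space $V$ a diffeological vector space. $V$ is projective if for every linear subduction $f:W_1\to W_2$ of diffeological vector spaces and every smooth linear map $g:V\to W_2$ there is a smooth linear map $h:V\to W_1$ with $g=f\circ h$. The smooth functionals (resp. smooth linear functionals) on $V$ separate points if for all $x\neq y$ in $V$ there is a smooth (resp. smooth linear) map $f:V\to\mathbb{R}$ with $f(x)\neq f(y)$. *)

(* Defs.v *)
From HB Require Import structures.
From mathcomp Require Import all_boot all_order all_algebra.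
From mathcomp Require Import all_classical all_reals all_analysis.
Set Implicit Arguments. Unset Strict Implicit. Unset Printing Implicit Defensive.
Import Order.TTheory GRing.Theory Num.Theory.
Import numFieldNormedType.Exports.
Local Open Scope classical_set_scope.
Local Open Scope ring_scope.

Section SmoothOn.
Context {R : realType} {m : nat} {W : normedModType R}.

(* [f] is of class C^k at every point of [U]; meant for open [U], where it only
   depends on the values of [f] on [U] (see [Ck_ext]).  Since the domain is
   finite-dimensional, the differential is of class C^k iff all directional
   derivatives ['D_v f] are. *)
Fixpoint Ck (k : nat) (U : set 'rV[R]_m) (f : 'rV[R]_m -> W) : Prop :=
  if k is k'.+1 then
    (forall x, U x -> differentiable f x) /\ (forall v, Ck k' U ('D_v f))
  else forall x, U x -> {for x, continuous f}.

Definition smooth_on (U : set 'rV[R]_m) (f : 'rV[R]_m -> W) : Prop :=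
  forall k, Ck k U f.

Lemma near_eq_differentiable (f g : 'rV[R]_m -> W) x :
  {near x, f =1 g} -> differentiable f x -> differentiable g x.
Proof.
move=> fg df; have [fc fo] := (diff_locallyP _ _).1 df.
have go : g \o shift x = cst (g x) + 'd f x +o_ 0 id.
  apply/eqaddoP => e e0; move/eqaddoP : fo => /(_ e e0).
  have : \forall y \near (0 : 'rV[R]_m), f (y + x) = g (y + x).
    have : \forall y \near x, f y = g y by [].
    by rewrite (near_shift 0) => fg0; apply: filterS fg0 => y /=; rewrite subr0.
  move=> fg0; apply: filterS2 fg0 => y /= fgy.
  have fgx : f x = g x by exact: (nbhs_singleton fg).
  by rewrite /= !fctE /= fgy fgx.
have dgE := diff_unique fc go.
by apply/diff_locallyP; rewrite dgE.
Qed.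

Lemma Ck_ext k (U : set 'rV[R]_m) f g :
  open U -> (forall x, U x -> f x = g x) -> Ck k U f -> Ck k U g.
Proof.
move=> oU; have near_fg f' g' x : (forall x, U x -> f' x = g' x) -> U x ->
    \forall y \near x, f' y = g' y :> W.
  by move=> fg Ux; apply: filterS (open_nbhs_nbhs (conj oU Ux)) => y /fg.
elim: k f g => [|k IH] f g fg /= => [fc x Ux|[df Dfc]].
  rewrite /prop_for /continuous_at -(fg _ Ux).
  exact: cvg_trans (near_eq_cvg (near_fg _ _ _ fg Ux)) (fc x Ux).
split=> [x Ux|v]; first exact: near_eq_differentiable (near_fg _ _ _ fg Ux) (df x Ux).
apply: IH (Dfc v) => x Ux.
by apply: near_eq_derive; exact: near_fg.
Qed.

Lemma Ck_sub k (U V : set 'rV[R]_m) f : V `<=` U -> Ck k U f -> Ck k V f.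
Proof.
move=> VU; elim: k f => [|k IH] f /= => [fc x /VU|[df Df]]; first exact: fc.
by split=> [x /VU|v]; [exact: df|exact: IH].
Qed.

Lemma Ck_bigcup k (F : set (set 'rV[R]_m)) f :
  (forall V, F V -> Ck k V f) -> Ck k (\bigcup_(V in F) V) f.
Proof.
elim: k f => [|k IH] f /= Ff; first by move=> x [V FV]; exact: Ff.
split=> [x [V FV]|v]; first exact: (Ff V FV).1.
by apply: IH => V FV; exact: (Ff V FV).2.
Qed.

Lemma CkW k (U : set 'rV[R]_m) f : Ck k.+1 U f -> Ck k U f.
Proof.
elim: k f => [|k IH] f [df Df]; last by split=> // v; exact: IH.
by move=> x Ux; exact/differentiable_continuous/df.
Qed.

Lemma Ck_cst k (U : set 'rV[R]_m) (a : W) : Ck k U (cst a).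
Proof.
elim: k a => [|k IH] a /=; first by move=> x _; exact: cst_continuous.
split=> [x _|v]; first exact: differentiable_cst.
rewrite (_ : 'D_v (cst a) = cst 0) //; apply/funext => x.
exact: derive_cst.
Qed.

End SmoothOn.

Section SmoothOnReal.
Context {R : realType}.

Lemma CkD m k (U : set 'rV[R]_m) (f g : 'rV[R]_m -> R) :
  open U -> Ck k U f -> Ck k U g -> Ck k U (f + g).
Proof.
move=> oU; elim: k f g => [|k IH] f g /=.
  by move=> fc gc x Ux; apply: continuousD; [exact: fc x Ux|exact: gc x Ux].
move=> [df Df] [dg Dg]; split=> [x Ux|v].
  by apply: differentiableD; [exact: df|exact: dg].
apply: (@Ck_ext _ _ _ _ _ ('D_v f + 'D_v g)) => //; last exact: IH.
by move=> x Ux; rewrite deriveD//; apply: diff_derivable; [exact: df|exact: dg].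
Qed.

Lemma CkM m k (U : set 'rV[R]_m) (f g : 'rV[R]_m -> R) :
  open U -> Ck k U f -> Ck k U g -> Ck k U (f * g).
Proof.
move=> oU; elim: k f g => [|k IH] f g.
  by move=> fc gc x Ux; apply: continuousM; [exact: fc x Ux|exact: gc x Ux].
move=> Cf Cg; have [[df Df] [dg Dg]] := (Cf, Cg); split=> [x Ux|v].
  by apply: differentiableM; [exact: df|exact: dg].
apply: (@Ck_ext _ _ _ _ _ (f * 'D_v g + g * 'D_v f)) => //.
  by move=> x Ux; rewrite deriveM//; apply: diff_derivable; [exact: df|exact: dg].
apply: CkD => //; first by apply: IH (Dg v); exact: CkW.
by apply: IH (Df v); exact: CkW.
Qed.

Lemma Ck_sum m k (U : set 'rV[R]_m) n (f : 'I_n -> 'rV[R]_m -> R) :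
  open U -> (forall i, Ck k U (f i)) -> Ck k U (\sum_i f i).
Proof.
move=> oU Cf; elim/big_ind : _ => // [|g h]; last exact: CkD.
exact: Ck_cst.
Qed.

Lemma Ck_coord m n k (U : set 'rV[R]_m) (g : 'rV[R]_m -> 'rV[R]_n) j :
  open U -> Ck k U g -> Ck k U (fun x => g x 0 j).
Proof.
move=> oU; elim: k g => [|k IH] g /=.
  move=> gc x Ux; apply: (@continuous_comp _ _ _ g (fun M : 'rV[R]_n => M 0 j)).
    exact: gc.
  exact: coord_continuous.
move=> [dg Dg]; split=> [x Ux|v].
  apply: (@differentiable_comp _ _ _ _ g (fun M : 'rV[R]_n => M 0 j)).
    exact: dg.
  exact: differentiable_coord.
apply: (Ck_ext oU _ (IH _ (Dg v))) => x Ux.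
by rewrite derive_mx ?mxE//; exact/diff_derivable/dg.
Qed.

Lemma Ck_comp m n k (U : set 'rV[R]_n) (V : set 'rV[R]_m)
    (f : 'rV[R]_n -> R) (g : 'rV[R]_m -> 'rV[R]_n) :
  open V -> V `<=` g @^-1` U -> Ck k U f -> Ck k V g -> Ck k V (f \o g).
Proof.
move=> oV gVU; elim: k f => [|k IH] f.
  move=> fc gc x Vx; apply: continuous_comp; first exact: gc.
  exact: fc (gVU _ Vx).
move=> [df Df] Cg; have [dg Dg] := Cg; split=> [x Vx|v].
  by apply: differentiable_comp; [exact: dg|exact/df/gVU].
apply: (@Ck_ext _ _ _ _ _
  (\sum_j (fun x => 'D_v g x 0 j) * ('D_(delta_mx 0 j) f \o g))) => //.
  move=> x Vx; have dgx := dg _ Vx; have dfgx := df _ (gVU _ Vx).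
  rewrite [RHS]deriveE; last exact: differentiable_comp.
  rewrite (diff_comp dgx dfgx)/= -[X in _ = _ X]deriveE//.
  rewrite ['D_v g x in RHS]row_sum_delta linear_sum fct_sumE.
  by apply: eq_bigr => j _; rewrite linearZ/= -deriveE.
apply: Ck_sum => // j; apply: CkM => //; first exact: Ck_coord (Dg v).
by apply: (IH _ _ (CkW Cg)); exact: Df.
Qed.

End SmoothOnReal.

(* A function U -> X is encoded by a total function on R^n; [plot_ext] says that
   only its values on U matter. [plot_cover] is the sheaf condition for the open
   cover [F] (open by [plot_open]). *)
Record diffeology (R : realType) (X : Type) := Diffeology {
  plot :> forall n, set 'rV[R]_n -> ('rV[R]_n -> X) -> Prop;
  plot_open : forall n (U : set 'rV[R]_n) p, plot U p -> open U;
  plot_ext : forall n (U : set 'rV[R]_n) p q,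
    (forall x, U x -> p x = q x) -> plot U p -> plot U q;
  plot_cst : forall n (U : set 'rV[R]_n) a, open U -> plot U (fun=> a);
  plot_comp : forall n m (U : set 'rV[R]_n) (V : set 'rV[R]_m) p
      (g : 'rV[R]_m -> 'rV[R]_n),
    plot U p -> open V -> smooth_on V g -> V `<=` g @^-1` U ->
    plot V (p \o g);
  plot_cover : forall n (F : set (set 'rV[R]_n)) p,
    (forall U, F U -> plot U p) -> plot (\bigcup_(U in F) U) p }.

Section Diffeology.
Context {R : realType}.

Definition smooth X Y (D : diffeology R X) (E : diffeology R Y) (f : X -> Y) :=
  forall n (U : set 'rV[R]_n) p, D n U p -> E n U (f \o p).

Definition subduction X Y (D : diffeology R X) (E : diffeology R Y)
    (f : X -> Y) :=
  forall n (U : set 'rV[R]_n) q, E n U q <->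
    open U /\ forall x, U x -> exists V : set 'rV[R]_n,
      [/\ open V, V x, V `<=` U &
          exists2 p, D n V p & forall y, V y -> q y = f (p y)].

Program Definition real_diffeology : diffeology R R :=
  {| plot n U f := open U /\ smooth_on U f |}.
Next Obligation. by move=> n U p []. Qed.
Next Obligation.
by move=> n U p q pq [oU sp]; split=> // k; exact: Ck_ext (sp k).
Qed.
Next Obligation. by move=> n U a oU; split=> // k; exact: Ck_cst. Qed.
Next Obligation.
move=> n m U V p g [oU sp] oV sg gVU; split=> // k.
exact: Ck_comp gVU (sp k) (sg k).
Qed.
Next Obligation.
move=> n F p Fp; split; first by apply: bigcup_open => U /Fp [].
by move=> k; apply: Ck_bigcup => U /Fp [].
Qed.

Program Definition prod_diffeology X Y (D : diffeology R X)
    (E : diffeology R Y) : diffeology R (X * Y) :=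
  {| plot n U p := D n U (fst \o p) /\ E n U (snd \o p) |}.
Next Obligation. by move=> X Y D E n U p [/plot_open]. Qed.
Next Obligation.
move=> X Y D E n U p q pq [D1 E1].
by split; [apply: plot_ext D1|apply: plot_ext E1] => x Ux /=; rewrite pq.
Qed.
Next Obligation. by move=> X Y D E n U a oU; split; exact: plot_cst. Qed.
Next Obligation.
move=> X Y D E n m U V p g [Dp Ep] oV sg gVU.
by split; [exact: plot_comp Dp oV sg gVU|exact: plot_comp Ep oV sg gVU].
Qed.
Next Obligation.
by move=> X Y D E n F p Fp; split; apply: plot_cover => U /Fp [].
Qed.

Program Definition sub_diffeology X (D : diffeology R X) (P : pred X)
    (S : subType P) : diffeology R S :=
  {| plot n U p := D n U (\val \o p) |}.
Next Obligation. by move=> X D P S n U p /plot_open. Qed.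
Next Obligation.
by move=> X D P S n U p q pq; apply: plot_ext => x Ux /=; rewrite pq.
Qed.
Next Obligation. by move=> X D P S n U a oU; exact: plot_cst. Qed.
Next Obligation.
by move=> X D P S n m U V p g Dp oV sg gVU; exact: plot_comp Dp oV sg gVU.
Qed.
Next Obligation. by move=> X D P S n F p Fp; exact: plot_cover. Qed.

Definition D_open X (D : diffeology R X) (A : set X) :=
  forall n (U : set 'rV[R]_n) p, D n U p -> open (U `&` p @^-1` A).

Definition D_topology (X : choiceType) (D : diffeology R X) : Type := X.

HB.instance Definition _ (X : choiceType) (D : diffeology R X) :=
  Choice.on (D_topology D).

Section DTopology.
Context (X : choiceType) (D : diffeology R X).

Lemma D_openT : D_open D setT.
Proof. by move=> n U p /plot_open; rewrite preimage_setT setIT. Qed.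

Lemma D_openI : setI_closed (D_open D).
Proof.
move=> A B oA oB n U p Dp; rewrite preimage_setI -[U]setIid setIACA.
by apply: openI; [exact: oA|exact: oB].
Qed.

Lemma D_open_bigcup (I : Type) (A : I -> set X) :
  (forall i, D_open D (A i)) -> D_open D (\bigcup_i A i).
Proof.
move=> oA n U p Dp; rewrite preimage_bigcup setI_bigcupr.
by apply: bigcup_open => i _; exact: oA.
Qed.

HB.instance Definition _ :=
  isOpenTopological.Build (D_topology D) D_openT D_openI D_open_bigcup.

End DTopology.
End Diffeology.

Definition vector_diffeology (R : realType) (V : lmodType R)
    (D : diffeology R V) : Prop :=
  smooth (prod_diffeology D D) D (fun u => u.1 + u.2) /\
  smooth (prod_diffeology real_diffeology D) D (fun u => u.1 *: u.2).

Record dvs (R : realType) := Dvs {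
  dvs_lmod :> lmodType R;
  dvs_diff : diffeology R dvs_lmod;
  dvs_diffP : vector_diffeology dvs_diff }.

Section Dvs.
Context {R : realType}.

Definition subspace_of (V : dvs R) (S : submodClosed V) : Type :=
  {x : V | x \in S}.

Section Subspace.
Context (V : dvs R) (S : submodClosed V).

HB.instance Definition _ := SubChoice.on (subspace_of S).
HB.instance Definition _ := [SubChoice_isSubLmodule of subspace_of S by <:].

Definition subspace_diffeology : diffeology R (subspace_of S) :=
  sub_diffeology (dvs_diff V) (subspace_of S).

Lemma subspace_diffP : vector_diffeology subspace_diffeology.
Proof.
have [sD sZ] := dvs_diffP V; split=> n U p [p1 p2].
  have := sD n U (fun x => (\val (p x).1, \val (p x).2)) (conj p1 p2).
  by apply: plot_ext.
have := sZ n U (fun x => ((p x).1, \val (p x).2)) (conj p1 p2).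
by apply: plot_ext.
Qed.

Definition subspace_dvs : dvs R := Dvs subspace_diffP.

End Subspace.

Definition finite_dimensional (V : lmodType R) : Prop :=
  exists n (b : 'I_n -> V), forall x, exists c : 'I_n -> R,
    x = \sum_i c i *: b i.

Definition fine (V : dvs R) : Prop :=
  forall D : diffeology R V, vector_diffeology D ->
    forall n (U : set 'rV[R]_n) p, dvs_diff V n U p -> D n U p.

Definition projective (V : dvs R) : Prop :=
  forall (W1 W2 : dvs R) (f : {linear W1 -> W2}) (g : {linear V -> W2}),
    subduction (dvs_diff W1) (dvs_diff W2) f ->
    smooth (dvs_diff V) (dvs_diff W2) g ->
    exists2 h : {linear V -> W1},
      smooth (dvs_diff V) (dvs_diff W1) h & g =1 f \o h.

End Dvs.

(* Collections are [Prop]-valued predicates rather than [set (dvs R)]: [dvs R]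
   lives in a universe above that of the parameter of [set]. *)
Section Collections.
Context (R : realType).
Implicit Types (V : dvs R) (C : dvs R -> Prop).

Definition included C1 C2 : Prop := forall V, C1 V -> C2 V.

Definition strictly_included C1 C2 : Prop :=
  included C1 C2 /\ ~ included C2 C1.

Definition FV V : Prop := fine V.

Definition PV V : Prop := projective V.

Definition SV V : Prop := forall x y : V, x <> y ->
  exists2 f : {scalar V}, smooth (dvs_diff V) real_diffeology f & f x <> f y.

Definition SD V : Prop := forall x y : V, x <> y ->
  exists2 f : V -> R, smooth (dvs_diff V) real_diffeology f & f x <> f y.

Definition FFV V : Prop := forall S : submodClosed V,
  finite_dimensional (subspace_dvs S) -> fine (subspace_dvs S).

Definition HT V : Prop := hausdorff_space (D_topology (dvs_diff V)).

End Collections.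

(* Main.v *)
Require Import Defs.
From HB Require Import structures.
From mathcomp Require Import all_boot all_order all_algebra.
From mathcomp Require Import all_classical all_reals all_analysis.
From mathcomp Require Import lra ring.

(** The inclusions rest on four observations.

    A linear map out of a fine space is smooth whatever its target
    ([fine_linear_smooth]), so for a fine space the lifting problem that defines
    projectivity is one of pure linear algebra, solved by [linear_lift].

    Every space [V] is the image of its [resolution], the free vector space on the
    points of the domains of its plots, under a linear subduction; products of
    coordinate functions show that smooth linear functionals separate points of
    the resolution ([resolution_SV]). If [V] is projective, the subduction has a
    smooth linear section, and [V] inherits the functionals.

    If [f] is a smooth functional, then its differential at [z], the map that
    sends [w] to the derivative of [f (z + t *: w)] at [t = 0], is a smooth linear
    functional. Hence smooth functionals separate points only if the linear ones
    do ([SD_SV]). On a finite-dimensional subspace finitely many of these are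
    coordinates, so every plot is a smooth combination of constant vectors
    ([separating_subspace_plot]) and the subspace is fine.

    Preimages of disjoint open sets under a separating smooth functional are
    D-open, which gives the Hausdorff property.

    Four examples show that the inclusions are strict.

    - [free_line], the free space on the line, is projective because plots over
      the line lift globally through a linear subduction: local lifts are glued by
      smooth step functions ([global_lift]). It is not fine, since some linear
      functionals on it are not smooth.
    - [sequences], a countable power of the line, is not projective. Plots of a
      resolution have locally bounded length, while a linear section would have to
      send every tail to vectors of unbounded length; a smooth curve through such
      vectors in smaller and smaller tails gives a contradiction.
    - [continuous_line], the line with all continuous maps as plots, is Hausdorff
      but not fine.
    - [fan] is a vector space modelled on Arens' sequential space: the vectors
      [spine n] tend to [apex] and, for each [n], the vectors [leaf n m] tend to
      [spine n], whereas [leaf n m] tends to [0] along every choice of [m] as a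
      function of [n]. Thus [apex] and [0] have no disjoint D-open neighbourhoods.
      Yet every plot is locally a plot of a space on which smooth linear
      functionals separate points, so finite-dimensional subspaces are fine.

    Since [SD] lies both in [FFV] and in [HT], the last two examples give the
    remaining strict inclusions as well. *)

Set Implicit Arguments. Unset Strict Implicit. Unset Printing Implicit Defensive.
Import Order.TTheory GRing.Theory Num.Theory.
Import numFieldNormedType.Exports.
Local Open Scope classical_set_scope.
Local Open Scope ring_scope.

(** * Smooth functions on Euclidean spaces *)

Section SmoothCalculus.
Context {R : realType}.

Lemma Ck_add m k (W : normedModType R) (U : set 'rV[R]_m) (f g : 'rV[R]_m -> W) :
  open U -> Ck k U f -> Ck k U g -> Ck k U (f + g).
Proof.
move=> oU; elim: k f g => [|k IH] f g /=.
  by move=> fc gc x Ux; apply: continuousD; [exact: fc x Ux|exact: gc x Ux].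
move=> [df Df] [dg Dg]; split=> [x Ux|v].
  by apply: differentiableD; [exact: df|exact: dg].
apply: (@Ck_ext _ _ _ _ _ ('D_v f + 'D_v g)) => //; last exact: IH.
by move=> x Ux; rewrite deriveD//; apply: diff_derivable; [exact: df|exact: dg].
Qed.

Lemma Ck_scalel m k (W : normedModType R) (U : set 'rV[R]_m) (f : 'rV[R]_m -> R)
    (w : W) : open U -> Ck k U f -> Ck k U (fun x => f x *: w).
Proof.
move=> oU; elim: k f => [|k IH] f /=.
  by move=> fc x Ux; apply: (@continuousZr_tmp _ _ _ f w); exact: fc.
move=> [df Df]; split=> [x Ux|v]; first exact/differentiableZl/df.
apply: (@Ck_ext _ _ _ _ _ (fun x => 'D_v f x *: w)) => //; last exact: IH.
move=> x Ux; rewrite [RHS]deriveE; last exact/differentiableZl/df.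
by rewrite diffZl -?deriveE//; exact: df.
Qed.

Lemma Ck_components m n k (U : set 'rV[R]_m) (g : 'rV[R]_m -> 'rV[R]_n) :
  open U -> (forall j, Ck k U (fun x => g x 0 j)) -> Ck k U g.
Proof.
move=> oU gj; have -> : g = \sum_j (fun x => g x 0 j *: delta_mx 0 j).
  by apply/funext => x; rewrite fct_sumE -row_sum_delta.
elim/big_ind : _ => [|f h Cf Ch|j _]; first exact: Ck_cst.
  exact: Ck_add.
exact: Ck_scalel.
Qed.

(** The induction on the order of differentiability has to pass to derivatives,
    so it is carried out for a whole class of functions of one variable that is
    stable under differentiation. *)
Lemma Ck_is_derive_closed (F : set (R -> R)) :
    (forall f, F f -> exists2 f', F f' & forall x, is_derive x (1 : R) f (f' x)) ->
  forall m k (U : set 'rV[R]_m) i f, open U -> F f -> Ck k U (fun u => f (u 0 i)).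
Proof.
move=> FP m k U i f oU; elim: k f => [|k IH] f Ff; have [f' Ff' ff'] := FP _ Ff.
  move=> x Ux; apply: (@continuous_comp _ _ _ (fun M : 'rV[R]_m => M 0 i) f).
    exact: coord_continuous.
  by apply/differentiable_continuous/derivable1_diffP; have [] := ff' (x 0 i).
have df (x : 'rV[R]_m) : differentiable f (x 0 i).
  by apply/derivable1_diffP; have [] := ff' (x 0 i).
have dc (x : 'rV[R]_m) := @differentiable_coord R 1 m x 0 i.
split=> [x Ux|v].
  by apply: (differentiable_comp (dc x)); exact: df.
have cl : forall x : 'rV[R]_m,
    'd (fun M : 'rV[R]_m => M 0 i : R) x v = v 0 i.
  move=> x; rewrite -deriveE//.
  have := @derive_mx R _ 1 m (@id 'rV[R]_m) x v (@derivable_id _ _ _ _).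
  by rewrite derive_id => /matrixP/(_ 0 i); rewrite mxE => ->.
apply: (@Ck_ext _ _ _ _ _ (fun u => f' (u 0 i) *: v 0 i)) => //; last first.
  by apply: Ck_scalel => //; exact: IH.
move=> x Ux; rewrite [RHS]deriveE; last by apply: differentiable_comp.
rewrite (diff_comp (dc x) (df x)) /= cl diff1E //.
by rewrite /GRing.scale/= mulrC derive1E; case: (ff' (x 0 i)) => _ ->.
Qed.

Lemma smooth_on_coord m (U : set 'rV[R]_m) i :
  open U -> smooth_on U (fun u => u 0 i).
Proof.
move=> oU k.
pose F := [set f : R -> R | f = id \/ exists c, f = cst c].
apply: (@Ck_is_derive_closed F _ m k U i id) => //; last by left.
move=> f [->|[c ->]].
  by exists (cst 1); [right; exists 1|move=> x; exact: is_derive_id].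
by exists (cst 0); [right; exists 0|move=> x; exact: is_derive_cst].
Qed.

Lemma smooth_on_components m n (U : set 'rV[R]_m) (g : 'rV[R]_m -> 'rV[R]_n) :
  open U -> (forall j, smooth_on U (fun x => g x 0 j)) -> smooth_on U g.
Proof. by move=> oU gj k; apply: Ck_components => // j; exact: gj. Qed.

Lemma smooth_on_comp m n (U : set 'rV[R]_n) (V : set 'rV[R]_m)
    (f : 'rV[R]_n -> R) (g : 'rV[R]_m -> 'rV[R]_n) :
  open V -> V `<=` g @^-1` U -> smooth_on U f -> smooth_on V g ->
  smooth_on V (f \o g).
Proof. by move=> oV gVU sf sg k; apply: Ck_comp gVU (sf k) (sg k). Qed.

Lemma smooth_on_ext m (W : normedModType R) (U : set 'rV[R]_m) (f g : 'rV[R]_m -> W) :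
  open U -> (forall x, U x -> f x = g x) -> smooth_on U f -> smooth_on U g.
Proof. by move=> oU fg sf k; exact: Ck_ext (sf k). Qed.

Lemma smooth_on_cst m (W : normedModType R) (U : set 'rV[R]_m) (a : W) :
  smooth_on U (fun=> a).
Proof. by move=> k; exact: Ck_cst. Qed.

Lemma smooth_on_sub m (W : normedModType R) (U V : set 'rV[R]_m) (f : 'rV[R]_m -> W) :
  V `<=` U -> smooth_on U f -> smooth_on V f.
Proof. by move=> VU sf k; exact: Ck_sub (sf k). Qed.

Lemma smooth_on_bigcup m (W : normedModType R) (F : set (set 'rV[R]_m))
    (f : 'rV[R]_m -> W) :
  (forall V, F V -> smooth_on V f) -> smooth_on (\bigcup_(V in F) V) f.
Proof. by move=> sf k; apply: Ck_bigcup => V FV; exact: sf. Qed.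

Lemma smooth_onD m (U : set 'rV[R]_m) (f g : 'rV[R]_m -> R) :
  open U -> smooth_on U f -> smooth_on U g -> smooth_on U (fun x => f x + g x).
Proof. by move=> oU sf sg k; exact: CkD. Qed.

Lemma smooth_onM m (U : set 'rV[R]_m) (f g : 'rV[R]_m -> R) :
  open U -> smooth_on U f -> smooth_on U g -> smooth_on U (fun x => f x * g x).
Proof. by move=> oU sf sg k; exact: CkM. Qed.

Lemma smooth_on_sum m (U : set 'rV[R]_m) n (f : 'I_n -> 'rV[R]_m -> R) :
  open U -> (forall i, smooth_on U (f i)) -> smooth_on U (fun x => \sum_i f i x).
Proof.
move=> oU sf k; have -> : (fun x => \sum_i f i x) = \sum_i f i.
  by apply/funext => x; rewrite fct_sumE.
by apply: Ck_sum => // i; exact: sf.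
Qed.

Lemma smooth_on_continuous m (W : normedModType R) (U : set 'rV[R]_m)
  (f : 'rV[R]_m -> W) x : smooth_on U f -> U x -> {for x, continuous f}.
Proof. by move=> /(_ 0%N); exact. Qed.

Lemma smooth_on_derive m (W : normedModType R) (U : set 'rV[R]_m)
  (f : 'rV[R]_m -> W) v : smooth_on U f -> smooth_on U ('D_v f).
Proof. by move=> sf k; have [_] := sf k.+1; exact. Qed.

Lemma smooth_on_differentiable m (W : normedModType R) (U : set 'rV[R]_m)
  (f : 'rV[R]_m -> W) x : smooth_on U f -> U x -> differentiable f x.
Proof. by move=> /(_ 1%N)[+ _]; exact. Qed.

Lemma smooth_onV m (U : set 'rV[R]_m) (f : 'rV[R]_m -> R) :
  open U -> (forall x, U x -> f x != 0) -> smooth_on U f ->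
  smooth_on U (fun x => (f x)^-1).
Proof.
move=> oU f0 sf; elim=> [|k IH].
  by move=> x Ux; apply: continuousV; [exact: f0|exact: smooth_on_continuous Ux].
split=> [x Ux|v].
  by apply: differentiableV; [exact: smooth_on_differentiable Ux|exact: f0].
apply: (@Ck_ext _ _ _ _ _ (cst (-1) * ((fun x => (f x)^-1) * (fun x => (f x)^-1))
   * 'D_v f)) => //.
  move=> x Ux; rewrite [RHS]deriveV; last 2 first.
  - exact: f0.
  - exact/diff_derivable/(smooth_on_differentiable sf).
  by rewrite !fctE mulN1r -invfM -expr2.
apply: CkM => //; last exact: smooth_on_derive.
by apply: CkM => //; [exact: Ck_cst|exact: CkM].
Qed.

End SmoothCalculus.

(** * Smooth step functions *)

Section Bump.
Context {R : realType}.

(** The factor [P] makes the class of these functions stable under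
    differentiation; the one needed in the end is [P = 1]. *)
Definition flat (P : {poly R}) (x : R) : R :=
  if 0 < x then P.[x^-1] * expR (- x^-1) else 0.

Lemma horner_le_expR (Q : {poly R}) :
  exists C, forall y, 0 <= y -> `|Q.[y]| <= C * expR y.
Proof.
exists (\sum_(i < size Q) `|Q`_i| * i`!%:R) => y y0.
rewrite horner_coef mulr_suml (le_trans (ler_norm_sum _ _ _))//.
apply: ler_sum => i _; rewrite normrM -mulrA ler_wpM2l// normrX ger0_norm//.
case: (val i) => [|n]; first by rewrite expr0 fact0 mul1r -expR0 ler_expR.
have n0 : 0 < (n.+1)`!%:R :> R by rewrite ltr0n fact_gt0.
rewrite mulrC -ler_pdivrMr//; apply: le_trans (expR_ge1Dxn n y0).
by rewrite lerDr.
Qed.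

(** The quadratic bound yields the derivative [0] at the origin. *)
Lemma flat_le_sqr P : exists C, forall x, `|flat P x| <= C * x ^+ 2.
Proof.
have [C CP] := horner_le_expR ('X^2 * P); exists `|C| => x.
rewrite /flat; case: ifPn => [x0|_]; last by rewrite normr0 mulr_ge0// sqr_ge0.
have xV0 : 0 <= x^-1 by rewrite invr_ge0 ltW.
have := CP _ xV0; rewrite hornerM hornerXn normrM normrX (ger0_norm xV0).
rewrite exprVn mulrC ler_pdivrMr ?exprn_gt0// => PC.
rewrite normrM (ger0_norm (expR_ge0 _)) expRN ler_pdivrMr ?expR_gt0//.
rewrite (le_trans PC)// mulrAC !ler_wpM2r ?sqr_ge0 ?expR_ge0//.
exact: ler_norm.
Qed.

Lemma flat_is_derive P x :
  is_derive x (1 : R) (flat P) (flat ('X^2 * (P - P^`())) x).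
Proof.
have [x0|x0|->] := ltgtP x 0.
- rewrite [X in is_derive _ _ _ X](_ : _ = 0); last by rewrite /flat ltNge ltW.
  apply: (@near_eq_is_derive R R R (cst 0)).
  near=> y; rewrite /flat ltNge ltW//=; near: y.
  by apply: open_nbhs_nbhs; split => //; exact: open_lt.
- apply: (@near_eq_is_derive R R R (fun y => P.[y^-1] * expR (- y^-1))).
    near=> y; rewrite /flat ifT//; near: y.
    by apply: open_nbhs_nbhs; split => //; exact: open_gt.
  have xV : is_derive x 1 (fun y : R => y^-1) (- x ^- 2).
    apply: is_derive_eq; first exact: (is_deriveV (f := id) (lt0r_neq0 x0)).
    by rewrite /GRing.scale/= mulr1.
  have dP : is_derive x 1 (fun y => P.[y^-1]) (P^`().[x^-1] * - x ^- 2).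
    exact: (@is_derive1_comp R (horner P) (fun y => y^-1) x).
  have dN : is_derive x 1 (fun y : R => - y^-1) (x ^- 2).
    by apply: is_derive_eq; rewrite opprK.
  have dE : is_derive x 1 (fun y => expR (- y^-1)) (expR (- x^-1) * x ^- 2).
    exact: (@is_derive1_comp R expR (fun y => - y^-1) x).
  apply: is_derive_eq.
  rewrite /flat x0 /GRing.scale/= hornerM hornerXn hornerD hornerN exprVn; ring.
- rewrite [X in is_derive _ _ _ X](_ : _ = 0); last by rewrite /flat ltxx.
  have [C PC] := flat_le_sqr P.
  have lim0 : (fun h => h^-1 *: ((flat P \o shift 0) (h *: (1:R)) - flat P 0))
      @ 0^' --> (0:R).
    apply/cvgrPdist_le => e e0; near=> h.
    have h0 : h != 0 by near: h; exact: nbhs_dnbhs_neq.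
    rewrite sub0r normrN /= addr0 [flat P 0]/flat ltxx subr0.
    rewrite /GRing.scale/= mulr1 normrM normfV mulrC ler_pdivrMr ?normr_gt0//.
    apply: le_trans (PC h) _; rewrite -(real_normK (num_real h)) expr2.
    rewrite mulrA ler_wpM2r//.
    apply: (@le_trans _ _ ((`|C| + 1) * `|h|)).
      by rewrite ler_wpM2r// (le_trans (ler_norm _))// lerDl.
    rewrite mulrC -ler_pdivlMr ?ltr_pwDr//.
    near: h; apply: dnbhs0_le; rewrite divr_gt0// ltr_pwDr//.
  apply: DeriveDef; first by apply/cvg_ex; exists 0.
  exact/cvg_lim.
Unshelve. all: by end_near. Qed.

Definition flat_exp (x : R) := flat 1 x.

Lemma flat_exp_gt0 x : (0 < flat_exp x) = (0 < x).
Proof.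
rewrite /flat_exp /flat; case: ifP => x0; last by rewrite ltxx.
by rewrite hornerC mul1r expR_gt0.
Qed.

Lemma flat_exp_ge0 x : 0 <= flat_exp x.
Proof.
rewrite /flat_exp /flat; case: ifP => x0 //.
by rewrite hornerC mul1r expR_ge0.
Qed.

Lemma flat_exp_eq0 x : x <= 0 -> flat_exp x = 0.
Proof. by rewrite /flat_exp /flat leNgt => /negbTE ->. Qed.

Lemma smooth_on_flat_exp m (U : set 'rV[R]_m) (f : 'rV[R]_m -> R) :
  open U -> smooth_on U f -> smooth_on U (fun u => flat_exp (f u)).
Proof.
move=> oU sf.
have sflat : smooth_on setT (fun u : 'rV[R]_1 => flat_exp (u 0 0)).
  move=> k; apply: (@Ck_is_derive_closed R [set flat P | P in setT]) => //.
  - move=> _ [P _ <-]; exists (flat ('X^2 * (P - P^`()))); first by eexists.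
    exact: flat_is_derive.
  - exact: openT.
apply: (@smooth_on_ext _ _ _ _ ((fun u : 'rV[R]_1 => flat_exp (u 0 0)) \o
  (fun u => \row__ f u))) => //.
  by move=> x Ux /=; rewrite mxE.
apply: smooth_on_comp sflat _ => //.
apply: smooth_on_components => // j; apply: smooth_on_ext sf => // x _.
by rewrite mxE.
Qed.

(** The step is [f / (f + g)] with [f] vanishing left of [a] and [g] right of
    [b]; since [a < b] the two never vanish together. *)
Lemma smooth_step (a b : R) : a < b ->
  exists2 s : R -> R, smooth_on setT (fun u : 'rV[R]_1 => s (u 0 0)) &
    (forall x, x <= a -> s x = 0) /\ (forall x, b <= x -> s x = 1).
Proof.
move=> ab; pose f x := flat_exp (x - a); pose g x := flat_exp (b - x).
have fg0 x : f x + g x != 0.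
  have [xb|bx] := ltP x b; apply: lt0r_neq0.
    by rewrite ltr_wpDl ?flat_exp_ge0// flat_exp_gt0 subr_gt0.
  by rewrite ltr_pwDl ?flat_exp_ge0// flat_exp_gt0 subr_gt0 (lt_le_trans ab).
exists (fun x => f x * (f x + g x)^-1).
  have sc : smooth_on setT (fun u : 'rV[R]_1 => u 0 0).
    exact: smooth_on_coord openT.
  have sf : smooth_on setT (fun u : 'rV[R]_1 => f (u 0 0)).
    apply: smooth_on_flat_exp; first exact: openT.
    by apply: (smooth_onD openT) => //; exact: smooth_on_cst.
  have sg : smooth_on setT (fun u : 'rV[R]_1 => g (u 0 0)).
    apply: smooth_on_flat_exp; first exact: openT.
    apply: (smooth_onD openT); first exact: smooth_on_cst.
    apply: (@smooth_on_ext _ _ _ _ (fun u : 'rV[R]_1 => -1 * u 0 0)).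
    - exact: openT.
    - by move=> x _; rewrite mulN1r.
    - by apply: (smooth_onM openT) => //; exact: smooth_on_cst.
  apply: (smooth_onM openT) => //; apply: (smooth_onV openT) => //.
  exact: (smooth_onD openT).
split=> x xab; first by rewrite /f flat_exp_eq0 ?mul0r// subr_le0.
have := fg0 x; rewrite /g flat_exp_eq0 ?subr_le0// addr0 => f0.
by rewrite divff.
Qed.

End Bump.

(** * Vector space diffeologies *)

Section VectorDiffeology.
Context {R : realType}.

Section Plots.
Context (V : lmodType R) (D : diffeology R V) (vD : vector_diffeology D).

Lemma plotD n (U : set 'rV[R]_n) p q :
  D n U p -> D n U q -> D n U (fun u => p u + q u).
Proof. by move=> Dp Dq; exact: (vD.1 n U (fun u => (p u, q u)) (conj Dp Dq)). Qed.

Lemma plotZ n (U : set 'rV[R]_n) (c : 'rV[R]_n -> R) p :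
  smooth_on U c -> D n U p -> D n U (fun u => c u *: p u).
Proof.
move=> sc Dp; apply: (vD.2 n U (fun u => (c u, p u))); split=> //.
by split=> //; exact: plot_open Dp.
Qed.

End Plots.

Lemma plot_sub X (D : diffeology R X) n (U V : set 'rV[R]_n) p :
  open V -> V `<=` U -> D n U p -> D n V p.
Proof.
move=> oV VU Dp; apply: (@plot_comp _ _ D n n U V p id) => //.
by apply: smooth_on_components => // j; exact: smooth_on_coord.
Qed.

Lemma plot_local X (D : diffeology R X) n (U : set 'rV[R]_n) p :
  (forall u, U u -> exists V, [/\ open V, V u, V `<=` U & D n V p]) -> D n U p.
Proof.
move=> H; have -> : U = \bigcup_(V in [set V | V `<=` U /\ D n V p]) V.
  apply/seteqP; split=> [u /H [V [oV Vu VU DV]]|u [V [VU _]]]; last exact: VU.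
  by exists V.
by apply: plot_cover => V [].
Qed.

Lemma real_vector_diffeology :
  @vector_diffeology R R^o (@real_diffeology R).
Proof.
split=> n U p [[oU sp] [_ sq]]; split=> //; first exact: smooth_onD.
exact: smooth_onM.
Qed.

Program Definition pullback_diffeology X Y (E : diffeology R Y) (h : X -> Y) :
    diffeology R X :=
  {| plot n U p := E n U (h \o p) |}.
Next Obligation. by move=> X Y E h n U p /plot_open. Qed.
Next Obligation.
by move=> X Y E h n U p q pq; apply: plot_ext => x Ux /=; rewrite pq.
Qed.
Next Obligation. by move=> X Y E h n U a oU; exact: plot_cst. Qed.
Next Obligation.
by move=> X Y E h n m U V p g Ep oV sg gVU; exact: plot_comp Ep oV sg gVU.
Qed.
Next Obligation. by move=> X Y E h n F p Fp; exact: plot_cover. Qed.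

Lemma pullback_vector_diffeology (V W : lmodType R) (E : diffeology R W)
    (h : V -> W) :
  linear h -> vector_diffeology E -> vector_diffeology (pullback_diffeology E h).
Proof.
move=> lh vE.
have h0 : h 0 = 0 by have := lh (-1) 0 0; rewrite scaler0 addr0 scaleN1r addNr.
split=> n U p [p1 p2].
  apply: plot_ext (plotD vE p1 p2) => u _ /=.
  by have := lh 1 (p u).1 (p u).2; rewrite !scale1r.
apply: plot_ext (plotZ vE p1.2 p2) => u _ /=.
by have := lh (p u).1 (p u).2 0; rewrite h0 !addr0.
Qed.

Program Definition weak_diffeology (V : lmodType R) (L : set (V -> R)) :
    diffeology R V :=
  {| plot n U p := open U /\ forall l, L l -> smooth_on U (l \o p) |}.
Next Obligation. by move=> V L n U p []. Qed.
Next Obligation.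
move=> V L n U p q pq [oU sp]; split=> // l Ll.
by apply: smooth_on_ext (sp l Ll) => // x Ux /=; rewrite pq.
Qed.
Next Obligation. by move=> V L n U a oU; split=> // l _; exact: smooth_on_cst. Qed.
Next Obligation.
move=> V L n m U W p g [oU sp] oW sg gWU; split=> // l Ll.
exact: (smooth_on_comp oW gWU (sp l Ll) sg).
Qed.
Next Obligation.
move=> V L n F p Fp; split; first by apply: bigcup_open => U /Fp [].
by move=> l Ll; apply: smooth_on_bigcup => U /Fp [_]; exact.
Qed.

Lemma weak_vector_diffeology (V : lmodType R) (L : set (V -> R)) :
  (forall l, L l -> scalar l) -> vector_diffeology (weak_diffeology L).
Proof.
move=> lL; split=> n U p [[oU p1] [_ p2]]; split=> // l Ll;
    have vl := @pullback_vector_diffeology V R^o _ _ (lL l Ll) real_vector_diffeology.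
  by have [] := plotD vl (conj oU (p1 l Ll)) (conj oU (p2 l Ll)).
by have [] := plotZ vl p1 (conj oU (p2 l Ll)).
Qed.

(** The smallest vector space diffeology containing [G]; it is an intersection,
    so a linear map out of it is smooth as soon as it is so on [G]. *)
Program Definition generated_diffeology (V : lmodType R)
    (G : forall n, set 'rV[R]_n -> ('rV[R]_n -> V) -> Prop) : diffeology R V :=
  {| plot n U p := open U /\ forall D : diffeology R V, vector_diffeology D ->
       (forall m A q, open A -> G m A q -> D m A q) -> D n U p |}.
Next Obligation. by move=> V G n U p []. Qed.
Next Obligation.
move=> V G n U p q pq [oU Dp]; split=> // D vD GD.
exact: plot_ext pq (Dp D vD GD).
Qed.
Next Obligation. by move=> V G n U a oU; split=> // D vD GD; exact: plot_cst. Qed.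
Next Obligation.
move=> V G n m U W p g [oU Dp] oW sg gWU; split=> // D vD GD.
exact: plot_comp (Dp D vD GD) oW sg gWU.
Qed.
Next Obligation.
move=> V G n F p Fp; split; first by apply: bigcup_open => U /Fp [].
by move=> D vD GD; apply: plot_cover => U /Fp [_]; exact.
Qed.

Section Generated.
Context (V : lmodType R) (G : forall n, set 'rV[R]_n -> ('rV[R]_n -> V) -> Prop).
Arguments G : clear implicits.

Lemma generated_vector_diffeology : vector_diffeology (generated_diffeology G).
Proof.
split=> n U p [p1 p2]; (split; first by have [] := p2) => D vD GD.
  by apply: plotD => //; [exact: (p1.2 D vD GD)|exact: (p2.2 D vD GD)].
by apply: plotZ => //; [exact: p1.2|exact: (p2.2 D vD GD)].
Qed.

Lemma generated_plot n U p : open U -> G n U p -> generated_diffeology G n U p.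
Proof. by move=> oU Gp; split=> // D vD GD; exact: GD. Qed.

Lemma generated_min (D : diffeology R V) : vector_diffeology D ->
  (forall m A q, open A -> G m A q -> D m A q) ->
  forall n U p, generated_diffeology G n U p -> D n U p.
Proof. by move=> vD GD n U p [_]; exact. Qed.

Lemma generated_smooth (W : lmodType R) (E : diffeology R W) (h : V -> W) :
  linear h -> vector_diffeology E ->
  (forall m A q, open A -> G m A q -> E m A (h \o q)) ->
  smooth (generated_diffeology G) E h.
Proof.
move=> lh vE GE n U p Gp.
exact: (generated_min (pullback_vector_diffeology lh vE)) Gp.
Qed.

End Generated.

Lemma smooth_id_dvs (V : dvs R) : smooth (dvs_diff V) (dvs_diff V) id.
Proof. by []. Qed.

(** The pullback of [E] is a vector space diffeology on [V], hence coarser than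
    the fine one. *)
Lemma fine_linear_smooth (V : dvs R) (W : lmodType R) (E : diffeology R W)
    (h : V -> W) :
  Defs.fine V -> linear h -> vector_diffeology E -> smooth (dvs_diff V) E h.
Proof.
by move=> fV lh vE n U p Vp; exact: (fV _ (pullback_vector_diffeology lh vE)).
Qed.

Lemma fine_scalar_smooth (V : dvs R) (l : V -> R) :
  Defs.fine V -> scalar l -> smooth (dvs_diff V) real_diffeology l.
Proof.
by move=> fV sl; exact: (@fine_linear_smooth V R^o) real_vector_diffeology.
Qed.

Lemma smooth_continuous_functional (V : dvs R) (f : V -> R) n U p u :
  smooth (dvs_diff V) real_diffeology f -> dvs_diff V n U p -> U u ->
  {for u, continuous (f \o p)}.
Proof. by move=> sf Vp Uu; have [_ /smooth_on_continuous] := sf _ _ _ Vp; exact. Qed.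

(** One vector of the family is split off at a time, by a functional that takes
    the value [1] on it after scaling; the others are projected along it. *)
Lemma separating_coordinates (V : lmodType R) (L : set (V -> R)) :
    (forall l, L l -> scalar l) ->
    (forall a l l', L l -> L l' -> L (fun x => a * l x + l' x)) ->
    (forall x, x != 0 -> exists2 l, L l & l x != 0) ->
  forall n (b : 'I_n -> V), exists (r : seq ((V -> R) * V)),
    (forall le, le \in r -> L le.1) /\
    forall c : 'I_n -> R, let x := \sum_i c i *: b i in
      x = \sum_(le <- r) le.1 x *: le.2.
Proof.
move=> linL LL sepL; elim=> [|n IH] b.
  by exists [::]; split=> // c /=; rewrite big_ord0 big_nil.
have [b0|/sepL [l Ll lb]] := eqVneq (b ord0) 0.
  have [r [rL rP]] := IH (fun i => b (lift ord0 i)); exists r; split=> // c /=.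
  rewrite big_ord_recl b0 scaler0 add0r.
  exact: (rP (fun i => c (lift ord0 i))).
have linl := linL _ Ll.
have l0 : l 0 = 0 by have := linl (-1) 0 0; rewrite scaler0 addr0 mulN1r addNr.
have lZ a x : l (a *: x) = a * l x by rewrite -[X in l X]addr0 linl l0 addr0.
have lD x y : l (x + y) = l x + l y by rewrite -[X in l (X + _)]scale1r linl mul1r.
have lS m (c : 'I_m -> R) (e : 'I_m -> V) :
    l (\sum_i c i *: e i) = \sum_i c i * l (e i).
  rewrite (big_morph l lD l0); apply: eq_bigr => i _; exact: lZ.
pose a := (l (b ord0))^-1; pose b0 := a *: b ord0.
have lb0 : l b0 = 1 by rewrite lZ mulVf.
have [r [rL rP]] := IH (fun i => b (lift ord0 i) - l (b (lift ord0 i)) *: b0).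
(* precomposing with the projection along [b0] keeps the functionals in [L] *)
pose proj (le : (V -> R) * V) := ((fun x => (- le.1 b0) * l x + le.1 x), le.2).
exists ((l, b0) :: map proj r); split.
  move=> le; rewrite inE => /orP[/eqP -> //|/mapP[le' ler ->]].
  by apply: LL => //; exact: rL.
move=> c x; rewrite big_cons big_map /=.
have xE : x - l x *: b0 = \sum_i c (lift ord0 i) *:
    (b (lift ord0 i) - l (b (lift ord0 i)) *: b0).
  rewrite /x lS !big_ord_recl scalerDl.
  have -> : (c ord0 * l (b ord0)) *: b0 = c ord0 *: b ord0.
    by rewrite /b0 /a scalerA mulfK.
  rewrite opprD addrACA subrr add0r scaler_suml -sumrB.
  by apply: eq_bigr => i _; rewrite scalerBr (scalerA (c _)) .
apply/eqP; rewrite addrC -subr_eq; apply/eqP.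
rewrite xE rP -xE big_seq [RHS]big_seq; apply: eq_bigr => le /rL /linL linle.
by rewrite addrC -scaleNr linle /= mulNr mulrC -mulNr.
Qed.

End VectorDiffeology.

(** * Free vector spaces *)

Section FreeVectorSpace.
Context (R : realType) (T : choiceType).

Definition supported (s : seq T) (f : T -> R^o) := forall t, t \notin s -> f t = 0.

Definition finsupp : {pred T -> R^o} := fun f => `[< exists s, supported s f >].

Fact finsupp_submod_closed : submod_closed finsupp.
Proof.
split; first by apply/asboolP; exists [::].
move=> a f g /asboolP[s sf] /asboolP[s' sg]; apply/asboolP.
exists (s ++ s') => t; rewrite mem_cat negb_or => /andP[ts ts'].
by rewrite !fctE sf // sg // scaler0 addr0.
Qed.

HB.instance Definition _ :=
  GRing.isSubmodClosed.Build R (T -> R^o) finsupp finsupp_submod_closed.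

Definition free : Type := {f : T -> R^o | f \in finsupp}.

HB.instance Definition _ := SubChoice.on free.
HB.instance Definition _ := [SubChoice_isSubLmodule of free by <:].

Definition coef (t : T) (w : free) : R := val w t.

Lemma coef_linear t : scalar (coef t).
Proof. by move=> a v w; rewrite /coef linearP. Qed.

HB.instance Definition _ t :=
  GRing.isLinear.Build R free R *%R (coef t) (coef_linear t).

Lemma free_supported (w : free) : exists s, uniq s /\ supported s (val w).
Proof.
case: w => f /= /[dup] + _ => /asboolP[s sf]; exists (undup s).
by rewrite undup_uniq; split=> // t; rewrite mem_undup; exact: sf.
Qed.

Lemma coef_eq (v w : free) : (forall t, coef t v = coef t w) -> v = w.
Proof. by move=> vw; apply/val_inj/funext. Qed.

Fact basis_subproof t : (fun t' => (t' == t)%:R) \in finsupp.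
Proof.
by apply/asboolP; exists [:: t] => t'; rewrite inE => /negbTE ->.
Qed.

Definition basis (t : T) : free :=
  exist (fun f : T -> R^o => f \in finsupp) _ (basis_subproof t).

Lemma coef_basis t t' : coef t' (basis t) = (t' == t)%:R.
Proof. by []. Qed.

Section Extension.
Context {V : lmodType R} (phi : T -> V).

Definition free_ext (w : free) : V :=
  \sum_(t <- sval (cid (free_supported w))) coef t w *: phi t.

Lemma free_extE s w : uniq s -> supported s (val w) ->
  free_ext w = \sum_(t <- s) coef t w *: phi t.
Proof.
rewrite /free_ext; case: cid => s' /= [us' ss'] us ss.
rewrite [LHS](bigID (mem s)) [RHS](bigID (mem s')) /=.
rewrite [X in _ + X]big1 => [|t /ss c0]; last by rewrite [coef t w]c0 scale0r.
rewrite [X in _ = _ + X]big1 => [|t /ss' c0]; last by rewrite [coef t w]c0 scale0r.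
rewrite !addr0 -[LHS]big_filter -[RHS]big_filter; apply: perm_big.
apply: uniq_perm; rewrite ?filter_uniq// => t.
by rewrite !mem_filter andbC.
Qed.

Lemma free_ext_is_linear : linear free_ext.
Proof.
move=> a v w; have [s [us ss]] := free_supported v.
have [s' [us' ss']] := free_supported w.
have sv : supported (undup (s ++ s')) (val v).
  by move=> t; rewrite mem_undup mem_cat negb_or => /andP[/ss].
have sw : supported (undup (s ++ s')) (val w).
  by move=> t; rewrite mem_undup mem_cat negb_or => /andP[_ /ss'].
have svw : supported (undup (s ++ s')) (val (a *: v + w)).
  by move=> t ts; have := coef_linear t a v w; rewrite /coef sv// sw// mulr0 addr0.
have u := undup_uniq (s ++ s').
rewrite (free_extE u sv) (free_extE u sw) (free_extE u svw).
rewrite scaler_sumr -big_split; apply: eq_bigr => t _ /=.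
by rewrite coef_linear scalerDl scalerA.
Qed.

HB.instance Definition _ :=
  GRing.isLinear.Build R free V *:%R free_ext free_ext_is_linear.

Lemma free_ext_basis t : free_ext (basis t) = phi t.
Proof.
rewrite (@free_extE [:: t])// => [|t' ]; last by rewrite inE /= => /negbTE ->.
by rewrite big_seq1 coef_basis eqxx scale1r.
Qed.

End Extension.

Lemma free_decomp s w : uniq s -> supported s (val w) ->
  w = \sum_(t <- s) coef t w *: basis t.
Proof.
move=> us ss; apply: coef_eq => t.
rewrite linear_sum.
under eq_bigr => t' _ do rewrite linearZ /= coef_basis.
have [ts|/[dup] tns /ss ct0] := boolP (t \in s).
  rewrite (bigD1_seq t) //= eqxx mulr1 big1 ?addr0// => t' /negbTE.
  by rewrite eq_sym => ->; rewrite mulr0.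
rewrite [LHS]ct0 big_seq big1// => t' t's; rewrite [t == t'](_ : _ = false) ?mulr0//.
by apply: contraNF tns => /eqP ->.
Qed.

Lemma free_linear_eq (V : lmodType R) (f g : {linear free -> V}) :
  (forall t, f (basis t) = g (basis t)) -> f =1 g.
Proof.
move=> fg w; have [s [us ss]] := free_supported w.
rewrite (free_decomp us ss) !linear_sum; apply: eq_bigr => t _.
by rewrite !linearZ /= fg.
Qed.

End FreeVectorSpace.
Arguments coef {R T}.
Arguments basis {R T}.
Arguments free_ext {R T V}.

(** * Fine finite-dimensional subspaces and smooth functionals *)

Section FiniteDimensional.
Context {R : realType}.

(** On a finite-dimensional subspace, finitely many functionals of [L] serve as
    coordinates, so a map smooth against [L] is a smooth combination of constant
    vectors, hence a plot for every vector space diffeology. *)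
Lemma separating_subspace_plot (V : dvs R) (L : set (V -> R)) (S : submodClosed V)
    (D : diffeology R (subspace_of S)) n (U : set 'rV[R]_n) p :
    (forall l, L l -> scalar l) ->
    (forall a l l', L l -> L l' -> L (fun x => a * l x + l' x)) ->
    (forall x, x != 0 -> exists2 l, L l & l x != 0) ->
    finite_dimensional (subspace_dvs S) -> vector_diffeology D -> open U ->
    (forall l, L l -> smooth_on U (l \o \val \o p)) ->
  D n U p.
Proof.
move=> linL LL sepL [k [b bS]] vD oU sp.
pose M := [set l \o (\val : subspace_of S -> V) | l in L].
have [|||r [rM rP]] := @separating_coordinates R (subspace_of S) M _ _ _ k b.
- by move=> _ [l /linL linl <-] a v w /=; rewrite -linl.
- move=> a _ _ [l Ll <-] [l' Ll' <-]; exists (fun x => a * l x + l' x) => //.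
  exact: LL.
- move=> x x0; have [|l Ll lx] := sepL (\val x); last by exists (l \o \val) => //; exists l.
  by apply: contraNneq x0 => x0; apply/eqP/val_inj; rewrite x0.
apply: (@plot_ext _ _ D _ _ (fun u => \sum_(le <- r) le.1 (p u) *: le.2)).
  by move=> u _; have [c ->] := bS (p u); rewrite -rP.
elim: r rM {rP} => [|le r IH] rM.
  by apply: plot_ext (plot_cst D 0 oU) => u _; rewrite big_nil.
have Dr := IH (fun le' ler => rM le' (mem_behead (s := le :: r) ler)).
have Dle : D n U (fun u => le.1 (p u) *: le.2).
  apply: plotZ => //; last exact: plot_cst.
  by have [l Ll <-] := rM le (mem_head _ _); exact: sp.
by apply: plot_ext (plotD vD Dle Dr) => u _; rewrite big_cons.
Qed.

Lemma eq_derive (V1 V2 W : normedModType R) (F : V1 -> W) (G : V2 -> W) x v y w :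
    (forall h : R, F (h *: v + x) = G (h *: w + y)) -> F x = G y ->
  'D_v F x = 'D_w G y.
Proof.
move=> FG Fx; rewrite /derive; set g1 := fun h => h^-1 *: _; set g2 := fun h => h^-1 *: _.
by suff -> : g1 = g2 by []; apply/funext => h; rewrite /g1 /g2 /= FG Fx.
Qed.

Section DirectionalDerivative.
Context (V : dvs R) (f : V -> R).
Hypothesis sf : smooth (dvs_diff V) real_diffeology f.

(** The differential of [f] at [z], which exists because [f] is smooth along
    every finite-dimensional affine subspace. *)
Definition directional (z w : V) : R := 'D_1 (fun t : R => f (z + t *: w)) 0.

Lemma derive_line m (F : 'rV[R]_m -> R) x v :
  'D_v F x = 'D_1 (fun t : R => F (x + t *: v)) 0.
Proof.
apply: eq_derive => [h|]; last by rewrite scale0r addr0.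
by rewrite addr0 [h *: 1]mulr1 addrC.
Qed.

(** For a plot [p], [directional z (p u)] is the partial derivative at [t = 0]
    of [f (z + t *: p u)], which is a smooth function of [(t, u)] because the
    vector space operations of [V] are smooth. *)
Lemma directional_smooth z : smooth (dvs_diff V) real_diffeology (directional z).
Proof.
move=> n U p Vp; have oU := plot_open Vp; split=> //.
pose U' : set 'rV[R]_(1 + n) := rsubmx @^-1` U.
have srs W : open W -> smooth_on W (rsubmx : 'rV[R]_(1 + n) -> 'rV[R]_n).
  move=> oW; apply: smooth_on_components => // j.
  by apply: smooth_on_ext (smooth_on_coord (rshift 1 j) oW) => // x _; rewrite mxE.
have oU' : open U'.
  apply: open_comp => // x _.
  exact: (smooth_on_continuous (srs setT openT)).
pose G (s : 'rV[R]_(1 + n)) : R := f (z + s 0 (lshift n 0) *: p (rsubmx s)).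
have sG : smooth_on U' G.
  have [|_ //] := sf (p := fun s => z + s 0 (lshift n 0) *: p (rsubmx s)) (U := U') _.
  apply: plotD; [exact: dvs_diffP|exact: plot_cst|].
  apply: plotZ; [exact: dvs_diffP|exact: smooth_on_coord|].
  by apply: (plot_comp Vp) => //; exact: srs.
pose e : 'rV[R]_(1 + n) := row_mx 1 0.
pose at0 (u : 'rV[R]_n) : 'rV[R]_(1 + n) := row_mx 0 u.
apply: (@smooth_on_ext _ _ _ U ('D_e G \o at0)) => //.
  move=> u Uu /=; rewrite derive_line /directional; congr ('D_(1 : R) _ 0).
  apply/funext => t; rewrite /G /at0 /e scale_row_mx add_row_mx row_mxKr row_mxEl.
  by rewrite !mxE scaler0 addr0 add0r mulr1n mulr1.
apply: (@smooth_on_comp _ _ _ U') => //.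
- by move=> u Uu; rewrite /U' /at0 /= row_mxKr.
- exact: smooth_on_derive.
apply: smooth_on_components => // j; case: (split_ordP j) => i ->.
  apply: (@smooth_on_ext _ _ _ _ (fun=> 0)) => //; last exact: smooth_on_cst.
  by move=> x _; rewrite /at0 row_mxEl mxE.
by apply: smooth_on_ext (smooth_on_coord i oU) => // x _; rewrite /at0 row_mxEr.
Qed.

(** Linearity only involves the plane through [z] spanned by two vectors, on
    which [f] is a smooth function of two real variables. *)
Lemma directional_scalar z : scalar (directional z).
Proof.
move=> a w w'; pose F (s : 'rV[R]_2) := f (z + (s 0 0 *: w + s 0 1 *: w')).
have sF : smooth_on setT F.
  have [|_ //] := sf (p := fun s : 'rV[R]_2 => z + (s 0 0 *: w + s 0 1 *: w'))
    (U := setT) _.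
  have vD := dvs_diffP V.
  apply: plotD; [exact: vD|exact: plot_cst openT|].
  by apply: plotD; [exact: vD|apply: plotZ => //; [exact: smooth_on_coord openT|
    exact: plot_cst openT]..].
have dF : differentiable F 0 by exact: smooth_on_differentiable sF _.
have dE (v : 'rV[R]_2) : directional z (v 0 0 *: w + v 0 1 *: w') = 'd F 0 v.
  rewrite -deriveE// derive_line /directional; congr ('D_(1 : R) _ 0); apply/funext => t.
  by rewrite /F !mxE !add0r scalerDr !scalerA.
have := dE (a *: delta_mx 0 0 + delta_mx 0 1); rewrite linearP -!dE !mxE /=.
by rewrite !mulr0 !mulr1 !add0r !addr0 !scale0r !scale1r ?add0r ?addr0.
Qed.

(** Otherwise [f] would have derivative [0] along the segment from [x] to [y]. *)
Lemma directional_neq0 x y : f x != f y -> exists z, directional z x != directional z y.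
Proof.
move=> fxy; apply: contrapT => dxy.
have d0 z : directional z (y - x) = 0.
  have -> : y - x = (-1) *: x + y by rewrite scaleN1r addrC.
  rewrite directional_scalar mulN1r; apply/eqP; rewrite addrC subr_eq0.
  by rewrite eq_sym; apply: contra_notT dxy => dz; exists z.
pose phi (t : R) := f (x + t *: (y - x)).
have phi' t : is_derive t (1 : R) phi 0.
  have sphi : smooth_on setT (fun u : 'rV[R]_1 => phi (u 0 0)).
    have [|_ //] := sf (p := fun u : 'rV[R]_1 => x + u 0 0 *: (y - x)) (U := setT) _.
    have vD := dvs_diffP V.
    apply: plotD; [exact: vD|exact: plot_cst openT|apply: plotZ => //].
      exact: smooth_on_coord openT.
    exact: plot_cst openT.
  have := diff_derivable (v := const_mx 1)
    (smooth_on_differentiable (x := const_mx t) sphi I).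
  move=> /derivable1P dphi.
  have -> : 0 = 'D_1 phi t.
    rewrite -(d0 (x + t *: (y - x))) /directional.
    apply: eq_derive => [h|]; last by rewrite scale0r addr0.
    by rewrite addr0 [h *: 1]mulr1 /phi -addrA -scalerDl [t + h]addrC.
  apply: derivableP; apply/derivable1P.
  suff -> : (fun h : R => phi (h *: (1 : R) + t)) =
      (fun h : R => phi ((h *: const_mx 1 + const_mx t : 'rV[R]_1) 0 0)) by [].
  by apply/funext => h; rewrite !mxE.
have /eqP := is_derive_0_is_cst 0 1 phi'.
by rewrite /phi scale0r addr0 scale1r addrC subrK (negbTE fxy).
Qed.

End DirectionalDerivative.

(** Differentials turn a separating smooth functional into a separating smooth
    linear one, so the inclusion of [SV] in [SD] is an equality. *)
Lemma SD_SV : included (@SD R) (@SV R).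
Proof.
move=> V sdV x y /sdV [f sf /eqP fxy].
have [z dz] := directional_neq0 sf fxy.
pose lz := GRing.isLinear.Build R V R *%R (directional f z) (directional_scalar sf z).
pose l : {scalar V} := HB.pack (directional f z) lz.
by exists l; [exact: directional_smooth|exact/eqP].
Qed.

Lemma SV_SD : included (@SV R) (@SD R).
Proof. by move=> V svV x y /svV [f sf fxy]; exists f. Qed.

(** Smooth linear functionals are closed under linear combinations, and by
    [SD_SV] they separate points, so [separating_subspace_plot] applies. *)
Lemma SD_FFV : included (@SD R) (@FFV R).
Proof.
move=> V /SD_SV svV S fdS D vD n U p Vp.
pose L := [set l : V -> R | scalar l /\ smooth (dvs_diff V) real_diffeology l].
apply: (@separating_subspace_plot V L S) => //.
- by move=> l [].
- move=> a l l' [linl sl] [linl' sl']; split.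
    by move=> b v w; rewrite linl linl' /=; ring.
  move=> m A q Vq; have [oA slq] := sl _ _ _ Vq; have [_ slq'] := sl' _ _ _ Vq.
  split=> //; apply: smooth_onD => //; apply: smooth_onM => //.
  exact: smooth_on_cst.
- move=> x /eqP /svV [l sl /eqP]; rewrite linear0 => lx; exists l => //.
  by split=> // a v w; rewrite linearP.
- exact: plot_open Vp.
- by move=> l [_ sl]; have [] := sl _ _ _ Vp.
Qed.

Lemma open_D_topology (X : choiceType) (D : diffeology R X) (A : set X) :
  @open (D_topology D) A = D_open D A.
Proof. by []. Qed.

Lemma SD_HT : included (@SD R) (@HT R).
Proof.
move=> V sdV; rewrite /HT open_hausdorff => x y /eqP /sdV [f sf /eqP fxy].
have := @Rhausdorff R; rewrite open_hausdorff => /(_ _ _ fxy).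
move=> [[A B] /= [fA fB] [oA oB /eqP AB0]].
have oD O : open O -> @open (D_topology (dvs_diff V)) (f @^-1` O).
  move=> oO; rewrite open_D_topology => n U p Vp; rewrite openE => u [Uu Ou]; apply: filterI.
    by apply: open_nbhs_nbhs; split=> //; exact: plot_open Vp.
  by apply: (smooth_continuous_functional sf Vp Uu); exact: open_nbhs_nbhs.
exists (f @^-1` A, f @^-1` B); first by rewrite !inE in fA fB *.
split=> /=; [exact: oD|exact: oD|].
by apply/eqP; rewrite -preimage_setI AB0 preimage_set0.
Qed.

End FiniteDimensional.

(** * The line with continuous plots *)

Section FullSubspace.
Context (R : realType) (V : lmodType R).

Definition full_pred : {pred V} := predT.

Fact full_submod_closed : submod_closed full_pred.
Proof. by []. Qed.

HB.instance Definition _ :=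
  GRing.isSubmodClosed.Build R V full_pred full_submod_closed.

Definition full : submodClosed V := full_pred.

End FullSubspace.

Section ContinuousLine.
Context {R : realType}.

(** All continuous maps are plots: the D-topology is still that of the line, but
    the identity functional is no longer smooth. *)
Program Definition continuous_diffeology : diffeology R R^o :=
  {| plot n U p := open U /\ Ck 0 U p |}.
Next Obligation. by move=> n U p []. Qed.
Next Obligation.
by move=> n U p q pq [oU Cp]; split=> //; exact: Ck_ext pq Cp.
Qed.
Next Obligation. by move=> n U a oU; split=> //; exact: Ck_cst. Qed.
Next Obligation.
by move=> n m U V p g [oU Cp] oV sg gVU; split=> //; exact: Ck_comp gVU Cp (sg 0%N).
Qed.
Next Obligation.
move=> n F p Fp; split; first by apply: bigcup_open => U /Fp [].
by apply: Ck_bigcup => U /Fp [].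
Qed.

Lemma continuous_vector_diffeology : vector_diffeology continuous_diffeology.
Proof.
split=> n U p [[oU Cp] [_ Cq]]; split=> //; first exact: CkD.
exact: CkM (Cp 0%N) Cq.
Qed.

Definition continuous_line : dvs R := Dvs continuous_vector_diffeology.

Lemma continuous_line_HT : HT continuous_line.
Proof.
rewrite /HT open_hausdorff => x y xy.
have := @Rhausdorff R; rewrite open_hausdorff => /(_ _ _ xy) [[A B] /= AB [oA oB AB0]].
have oD (O : set R) : open O -> D_open continuous_diffeology O.
  move=> oO n U p [oU Cp]; rewrite openE => u [Uu Ou].
  apply: filterI; first exact: open_nbhs_nbhs.
  by apply: (Cp u Uu O); exact: open_nbhs_nbhs.
by exists (A, B) => //; split=> //; exact: oD.
Qed.

(** By symmetry the derivative at [0] could only be [0], while the difference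
    quotients have absolute value [1]. *)
Lemma norm_not_smooth : ~ smooth_on setT (fun u : 'rV[R]_1 => `|u 0 0| : R).
Proof.
set F := (F in smooth_on _ F) => sF.
have dF : differentiable F 0 := smooth_on_differentiable sF I.
pose v : 'rV[R]_1 := const_mx 1.
have D0 : 'D_v F 0 = 0.
  have Dv : 'D_(- v) F 0 = 'D_v F 0.
    apply: eq_derive => // h.
    by rewrite /F !mxE !addr0 mulrN mulr1 normrN.
  have : 'D_(- v) F 0 = - 'D_v F 0 by rewrite !deriveE// linearN.
  rewrite Dv => /eqP; rewrite -subr_eq0 opprK -mulr2n mulrn_eq0 /=.
  by move=> /eqP.
have := diff_derivable (v := v) dF; rewrite /derivable => Fv.
have : (fun h => h^-1 *: ((F \o shift 0) (h *: v) - F 0)) @ 0^' --> (0 : R).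
  by rewrite -[X in _ --> X]D0; exact: Fv.
move=> /cvgrPdist_lt /(_ 1 ltr01) /= near1.
have near0 : \forall h \near 0^', h != 0 :> R by exact: nbhs_dnbhs_neq.
have /= := @filter_ex _ _ (Proper_dnbhs_numFieldType (0 : R)) _ (filterI near1 near0).
move=> /(_ _)[h [+ h0]].
rewrite sub0r normrN addr0 /F !mxE normr0 subr0 mulr1 /GRing.scale/=.
by rewrite normrM normr_id normfV mulVf ?normr_eq0// ltxx.
Qed.

Lemma continuous_line_not_FFV : ~ FFV continuous_line.
Proof.
move=> /(_ (full continuous_line)) ffv.
pose S := subspace_dvs (full continuous_line).
pose inS (x : R) : S := exist (fun x : R^o => x \in @full_pred R R^o) x isT.
have fS : Defs.fine S.
  apply: ffv; exists 1%N, (fun=> inS 1) => x; exists (fun=> \val x).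
  by rewrite big_ord1; apply: val_inj; rewrite linearZ /= /GRing.scale/= mulr1.
have [] := @fine_scalar_smooth _ S \val fS _ 1%N setT (fun u => inS `|u 0 0|).
- by move=> a x y; rewrite linearP.
- split; first exact: openT.
  move=> u _ /=; apply: (@continuous_comp _ _ _ (fun M : 'rV[R]_1 => M 0 0)).
    exact: coord_continuous.
  exact: norm_continuous.
by move=> _ /norm_not_smooth.
Qed.

Lemma HT_not_FFV : ~ included (@HT R) (@FFV R).
Proof. by move=> /(_ _ continuous_line_HT); exact: continuous_line_not_FFV. Qed.

End ContinuousLine.

(** * Null sequences *)

Section NullSequences.
Context {R : realType}.

Definition dyadic (n : nat) : R := 2^-1 ^+ n.

Lemma dyadic_gt0 n : 0 < dyadic n.
Proof. by rewrite exprn_gt0// invr_gt0. Qed.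

Lemma dyadic_near0 (P : 'rV[R]_1 -> Prop) :
  (\forall u \near (0 : 'rV[R]_1), P u) ->
  exists N, forall n, (N <= n)%N -> P (const_mx (dyadic n)).
Proof.
move=> P0.
have c : (fun n => dyadic n *: (const_mx 1 : 'rV[R]_1)) @ \oo --> (0 : 'rV[R]_1).
  rewrite -[X in _ --> X](scale0r (const_mx 1 : 'rV[R]_1)).
  apply: cvgZr_tmp; apply: cvg_expr.
  by rewrite ger0_norm ?invr_ge0// invf_lt1 ?ltr1n.
have [N _ NP] := c _ P0; exists N => n Nn.
have := NP n Nn; rewrite /= (_ : _ *: _ = const_mx (dyadic n))//.
by apply/matrixP => i j; rewrite !mxE mulr1.
Qed.

(** A bump equal to [1] at [dyadic n] and supported between [3/4] and [3/2] of
    it; the ratio of these bounds is [2], so distinct bumps have disjoint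
    supports. The denominator is the value of the numerator at [s = 1]. *)
Definition dyadic_bump (n : nat) (t : R) : R :=
  let s := t / dyadic n in
  flat_exp ((s - 3 / 4) * (3 / 2 - s)) / flat_exp (1 / 8).

Lemma dyadic_bump_small n t : t <= 3 / 4 * dyadic n -> dyadic_bump n t = 0.
Proof.
rewrite -ler_pdivrMr ?dyadic_gt0// /dyadic_bump; set s := t / _ => s34.
by rewrite flat_exp_eq0 ?mul0r//; nra.
Qed.

Lemma dyadic_bump_large n t : 3 / 2 * dyadic n <= t -> dyadic_bump n t = 0.
Proof.
rewrite -ler_pdivlMr ?dyadic_gt0// /dyadic_bump; set s := t / _ => s32.
by rewrite flat_exp_eq0 ?mul0r//; nra.
Qed.

Lemma dyadic_half m n : (m < n)%N -> dyadic n <= 2^-1 * dyadic m.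
Proof.
by move=> mn; rewrite -exprS ler_wiXn2l// ?invr_ge0// invf_le1 ?ler1n.
Qed.

Lemma dyadic_bump_dyadic n m : dyadic_bump n (dyadic m) = (n == m)%:R.
Proof.
have n0 := dyadic_gt0 n; have m0 := dyadic_gt0 m.
have [/dyadic_half h|/dyadic_half h|->] := ltngtP n m.
- by rewrite dyadic_bump_small//; lra.
- by rewrite dyadic_bump_large//; lra.
rewrite /dyadic_bump divff ?lt0r_neq0 ?dyadic_gt0//.
have -> : ((1 - 3 / 4) * (3 / 2 - 1) : R) = 1 / 8 by field.
by rewrite divff// lt0r_neq0// flat_exp_gt0.
Qed.

Lemma dyadic_bump_eventually0 t :
  exists N, forall n, (N <= n)%N -> dyadic_bump n t = 0.
Proof.
have [t0|t0] := leP t 0.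
  exists 0%N => n _; apply: dyadic_bump_small.
  by rewrite (le_trans t0)// mulr_ge0// ltW// dyadic_gt0.
have : (fun n => dyadic n) @ \oo --> (0 : R).
  by apply: cvg_expr; rewrite ger0_norm ?invr_ge0// invf_lt1 ?ltr1n.
move=> /cvgrPdist_lt /(_ (t / 2)); rewrite divr_gt0// => /(_ isT) [N _ NP].
exists N => n /NP /=; rewrite sub0r normrN gtr0_norm ?dyadic_gt0// => nt.
by apply: dyadic_bump_large; lra.
Qed.

Lemma smooth_on_dyadic_bump n :
  smooth_on setT (fun u : 'rV[R]_1 => dyadic_bump n (u 0 0)).
Proof.
have sc (a : R) : smooth_on setT (fun _ : 'rV[R]_1 => a) by exact: smooth_on_cst.
have ss : smooth_on setT (fun u : 'rV[R]_1 => u 0 0 / dyadic n).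
  by apply: (smooth_onM openT) => //; exact: smooth_on_coord openT.
apply: (smooth_onM openT) => //; apply: smooth_on_flat_exp; first exact: openT.
apply: (smooth_onM openT); first exact: (smooth_onD openT).
apply: (smooth_onD openT) => //.
apply: (@smooth_on_ext _ _ _ _ (fun u : 'rV[R]_1 => -1 * (u 0 0 / dyadic n))).
- exact: openT.
- by move=> u _; rewrite mulN1r.
- exact: (smooth_onM openT).
Qed.

(** A curve through [v n] at time [2 ^- n] and through [0] at time [0]: the
    D-topology cannot tell such a sequence from a sequence converging to [0]. *)
Definition null_sequence (V : lmodType R) (D : diffeology R V) (v : nat -> V) :=
  exists k : 'rV[R]_1 -> V,
    [/\ D 1%N setT k, k 0 = 0 & forall n, k (const_mx (dyadic n)) = v n].

(** The curve is the sum of the [dyadic_bump n t *: v n], finite at each time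
    [t]; composed with a functional that vanishes on a tail of [v], it becomes one
    finite sum of smooth functions for all [t]. *)
Lemma weak_null_sequence (V : lmodType R) (L : set (V -> R)) (v : nat -> V) :
    (forall l, L l -> scalar l) ->
    (forall l, L l -> exists N, forall n, (N <= n)%N -> l (v n) = 0) ->
  null_sequence (weak_diffeology L) v.
Proof.
move=> linL Lv.
pose N t := sval (cid (dyadic_bump_eventually0 t)).
have NP t n : (N t <= n)%N -> dyadic_bump n t = 0.
  by rewrite /N; case: cid => /= M; apply.
pose k t := \sum_(n < N t) dyadic_bump n t *: v n.
exists (fun u => k (u 0 0)); split.
- split; first exact: openT.
  move=> l Ll; have linl := linL _ Ll; have [M MP] := Lv _ Ll.
  apply: (@smooth_on_ext _ _ _ _
    (fun u : 'rV[R]_1 => \sum_(n < M) dyadic_bump n (u 0 0) * l (v n))).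
  + exact: openT.
  + move=> u _; rewrite /= /k; set t := u 0 0.
    pose ll := GRing.isLinear.Build R V R *%R l linl.
    pose l' : {scalar V} := HB.pack l ll.
    have -> : l (\sum_(n < N t) dyadic_bump n t *: v n) =
        \sum_(n < N t) dyadic_bump n t * l (v n).
      by rewrite -[LHS]/(l' _) linear_sum; apply: eq_bigr => i _; rewrite linearZ.
    pose F n := dyadic_bump n t * l (v n).
    have ext K : (forall n, (K <= n)%N -> F n = 0) ->
        \sum_(n < K) F n = \sum_(n < maxn (N t) M) F n :> R \/ (maxn (N t) M < K)%N.
      move=> K0; have [KNM|] := leqP K (maxn (N t) M); last by right.
      left; rewrite -!(big_mkord xpredT F) [RHS](big_cat_nat (leq0n K) KNM) /=.
      by rewrite [X in _ = _ + X]big_nat [X in _ = _ + X]big1 ?addr0// => i /andP[/K0].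
    (* terms from [M] on vanish because of [l], those from [N t] on because of
       the bumps *)
    have [|->|] := ext M.
    * by move=> n /MP; rewrite /F => ->; rewrite mulr0.
    * have [|->//|] := ext (N t).
        by move=> n /NP; rewrite /F => ->; rewrite mul0r.
      by rewrite ltnNge leq_maxl.
    by rewrite ltnNge leq_maxr.
  apply: (smooth_on_sum openT) => n; apply: (smooth_onM openT).
    exact: smooth_on_dyadic_bump.
  exact: smooth_on_cst.
- rewrite /k mxE big1// => n _; rewrite dyadic_bump_small ?scale0r//.
  by rewrite mulr_ge0// ltW// dyadic_gt0.
move=> n; rewrite mxE /k.
have nN : (n < N (dyadic n))%N.
  rewrite ltnNge; apply/negP => /NP; rewrite dyadic_bump_dyadic eqxx => /eqP.
  by rewrite oner_eq0.
rewrite (bigD1 (Ordinal nN))//= dyadic_bump_dyadic eqxx scale1r big1 ?addr0//.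
move=> i; rewrite dyadic_bump_dyadic -val_eqE /= => /negbTE ->.
by rewrite scale0r.
Qed.

Lemma null_sequence_D_open (V : lmodType R) (D : diffeology R V) (v : nat -> V) z
    (A : set V) : vector_diffeology D ->
    null_sequence D v -> D_open D A -> A z ->
  exists N, forall n, (N <= n)%N -> A (z + v n).
Proof.
move=> vD [k [Dk k0 kv]] oA Az.
have /oA := plotD vD (plot_cst D z openT) Dk; rewrite setTI => okA.
have [|N NP] := @dyadic_near0 ((fun u => z + k u) @^-1` A).
  by apply: open_nbhs_nbhs; split=> //; rewrite /= k0 addr0.
by exists N => n /NP /=; rewrite kv.
Qed.

End NullSequences.

(** * Unions of diffeologies *)

Section Union.
Context {R : realType}.

(** A union of diffeologies is not closed under gluing, so its plots are required
    to lie in a member of the family only locally. *)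
Program Definition union_diffeology X (I : Type) (i0 : I)
    (D : I -> diffeology R X) : diffeology R X :=
  {| plot n U p := open U /\ forall u, U u -> exists i V,
       [/\ open V, V u, V `<=` U & D i n V p] |}.
Next Obligation. by move=> X I i0 D n U p []. Qed.
Next Obligation.
move=> X I i0 D n U p q pq [oU Dp]; split=> // u /Dp [i [V [oV Vu VU DV]]].
exists i, V; split=> //; apply: plot_ext DV => x /VU; exact: pq.
Qed.
Next Obligation.
move=> X I i0 D n U a oU; split=> // u Uu; exists i0, U; split=> //.
exact: plot_cst.
Qed.
Next Obligation.
move=> X I i0 D n m U V p g [oU Dp] oV sg gVU; split=> // v Vv.
have [i [W [oW Wgv WU DW]]] := Dp _ (gVU _ Vv).
have oVW : open (V `&` g @^-1` W).
  rewrite openE => x [Vx Wx]; apply: filterI; first exact: open_nbhs_nbhs.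
  by apply: (smooth_on_continuous sg Vx); exact: open_nbhs_nbhs.
exists i, (V `&` g @^-1` W); split=> //.
by apply: (plot_comp DW) => //; apply: smooth_on_sub sg.
Qed.
Next Obligation.
move=> X I i0 D n F p Fp; split; first by apply: bigcup_open => U /Fp [].
move=> u [U FU Uu]; have [_ /(_ _ Uu) [i [V [oV Vu VU DV]]]] := Fp _ FU.
by exists i, V; split=> // x /VU Ux; exists U.
Qed.

Lemma union_plot X (I : Type) (i0 i : I) (D : I -> diffeology R X) n U p :
  D i n U p -> union_diffeology i0 D n U p.
Proof.
by move=> Dp; split=> [|u Uu]; [exact: plot_open Dp|exists i, U; split=> //;
  exact: plot_open Dp].
Qed.

Lemma union_vector_diffeology (V : lmodType R) (I : Type) (i0 : I)
    (D : I -> diffeology R V) :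
    (forall i, vector_diffeology (D i)) ->
    (forall i j, exists k, forall n U p, D i n U p \/ D j n U p -> D k n U p) ->
  vector_diffeology (union_diffeology i0 D).
Proof.
move=> vD dir; split=> n U p [].
  move=> [oU D1] [_ D2]; split=> // u Uu.
  have [i [V1 [oV1 V1u V1U DV1]]] := D1 _ Uu.
  have [j [V2 [oV2 V2u V2U DV2]]] := D2 _ Uu.
  have [k Dk] := dir i j; exists k, (V1 `&` V2).
  have oV := openI oV1 oV2; split=> //; first by move=> x [/V1U].
  apply: (plotD (vD k)); apply: Dk; [left|right].
    by apply: plot_sub DV1 => // x [].
  by apply: plot_sub DV2 => // x [].
move=> [oU D1] [_ D2]; split=> // u Uu.
have [i [W [oW Wu WU DW]]] := D2 _ Uu; exists i, W; split=> //.
by apply: (plotZ (vD i)) => //; exact: smooth_on_sub D1.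
Qed.

End Union.

(** * A non-Hausdorff space with fine finite-dimensional subspaces *)

Section SequentialFan.
Context {R : realType}.

Local Notation V := (free R (nat * nat)%type).

Definition apex : V := basis (0, 0)%N.
Definition spine n : V := basis (n.+1, 0)%N.
Definition leaf n m : V := basis (n.+1, m.+1)%N.

(** Each clause makes sequences null for the weak diffeology of these
    functionals; only the last depends on [b], and it becomes stronger as [b]
    grows, so that the weak diffeologies form a directed family. *)
Definition fan_functional (b : nat -> nat) : set (V -> R) :=
  [set l | [/\ scalar l,
    exists N, forall n, (N <= n)%N -> l (spine n) = l apex,
    forall n, exists M, forall m, (M <= m)%N -> l (leaf n m) = l (spine n) &
    exists N, forall n m, (N <= n)%N -> (m <= b n)%N -> l (leaf n m) = 0]].

Lemma fan_functional_closed b a l l' : fan_functional b l -> fan_functional b l' ->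
  fan_functional b (fun x => a * l x + l' x).
Proof.
move=> [ll [N1 s1] l1 [N1' z1]] [ll' [N2 s2] l2 [N2' z2]]; split.
- by move=> c x y; rewrite ll ll' /=; ring.
- exists (maxn N1 N2) => n; rewrite geq_max => /andP[n1 n2].
  by rewrite s1// s2.
- move=> n; have [M1 M1P] := l1 n; have [M2 M2P] := l2 n.
  exists (maxn M1 M2) => m; rewrite geq_max => /andP[m1 m2].
  by rewrite M1P// M2P.
- exists (maxn N1' N2') => n m; rewrite geq_max => /andP[n1 n2] mb.
  by rewrite z1// z2// mulr0 addr0.
Qed.

Lemma fan_functional_ext b (phi : nat * nat -> R^o) :
    (exists N, forall n, (N <= n)%N -> phi (n.+1, 0%N) = phi (0, 0)%N) ->
    (forall n, exists M, forall m, (M <= m)%N -> phi (n.+1, m.+1) = phi (n.+1, 0%N)) ->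
    (exists N, forall n m, (N <= n)%N -> (m <= b n)%N -> phi (n.+1, m.+1) = 0) ->
  fan_functional b (free_ext phi).
Proof.
move=> h1 h2 h3; split.
- by move=> a x y; rewrite linearP.
- by case: h1 => N NP; exists N => n /NP; rewrite !free_ext_basis.
- by move=> n; case: (h2 n) => M MP; exists M => m /MP; rewrite !free_ext_basis.
- by case: h3 => N NP; exists N => n m Nn mb; rewrite free_ext_basis NP.
Qed.

(** A leaf or a spine vector in the support of [x] is detected by a functional
    concentrated on it, or on it and its leaves. The indices [(0, m.+1)] occur in
    no clause of [fan_functional] and are treated like leaves. What remains is the
    apex, which is detected by letting all leaves beyond the bound [b] follow it. *)
Lemma fan_functional_separate b (x : V) : x != 0 ->
  exists2 l, fan_functional b l & l x != 0.
Proof.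
move=> x0; have [s [us ss]] := free_supported x.
have fE (phi : nat * nat -> R^o) : free_ext phi x = \sum_(t <- s) coef t x *: phi t.
  exact: free_extE.
have point t (phi : nat * nat -> R^o) : coef t x != 0 -> phi t = 1 ->
    (forall t', t' != t -> coef t' x != 0 -> phi t' = 0) -> free_ext phi x != 0.
  move=> ct pt pt'; have ts : t \in s.
    by apply: contraNT ct => /ss ct; rewrite [coef t x]ct.
  rewrite fE (bigD1_seq t)//= pt big1 ?addr0 => [|t' tt'].
    by rewrite /GRing.scale/= mulr1.
  have [->|ct'] := eqVneq (coef t' x) 0; first by rewrite scale0r.
  by rewrite pt'// scaler0.
have [[n [m c]]|noleaf] := pselect (exists n m, coef (n.+1, m.+1) x != 0).
  exists (free_ext (fun t => (t == (n.+1, m.+1))%:R : R^o)); last first.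
    by apply: (point _ _ c); rewrite ?eqxx// => t' /negbTE ->.
  apply: fan_functional_ext.
  - by exists 0%N => n' _; rewrite !xpair_eqE /= andbF.
  - move=> n'; exists m.+1 => m' mm'.
    by rewrite !xpair_eqE !eqSS (gtn_eqF mm') !andbF.
  - exists n.+1 => n' m' nn' _.
    by rewrite !xpair_eqE !eqSS (gtn_eqF nn').
have [[n c]|nospine] := pselect (exists n, coef (n.+1, 0%N) x != 0).
  exists (free_ext (fun t => (t.1 == n.+1)%:R : R^o)); last first.
    apply: (point _ _ c); rewrite ?eqxx// => -[n' [|m']].
      by rewrite xpair_eqE eqxx andbT /= => /negbTE ->.
    by case: n' => [//|n'] _ ct; case: noleaf; exists n', m'.
  apply: fan_functional_ext.
  - by exists n.+1 => n' nn'; rewrite /= eqSS (gtn_eqF nn').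
  - by move=> n'; exists 0%N.
  - by exists n.+1 => n' m' nn' _; rewrite /= eqSS (gtn_eqF nn').
have c : coef (0, 0)%N x != 0 \/ exists m, coef (0, m.+1)%N x != 0.
  apply: contrapT => /not_orP [c00 c0m]; move/eqP: x0; apply; apply: coef_eq.
  move=> [[|n] [|m]]; apply/eqP; apply: contrapT => /negP c.
  - exact: c00.
  - by apply: c0m; exists m.
  - by apply: nospine; exists n.
  - by apply: noleaf; exists n, m.
have [[m c0m]|no0] := pselect (exists m, coef (0, m.+1)%N x != 0).
  exists (free_ext (fun t => (t == (0, m.+1)%N)%:R : R^o)); last first.
    by apply: (point _ _ c0m); rewrite ?eqxx// => t' /negbTE ->.
  by apply: fan_functional_ext; [exists 0%N|move=> n; exists 0%N|exists 0%N].
have c00 : coef (0, 0)%N x != 0 by case: c => // /no0.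
exists (free_ext (fun t => if t is (n.+1, m.+1) then (b n < m)%:R else 1 : R^o)).
  apply: fan_functional_ext.
  - by exists 0%N.
  - by move=> n; exists (b n).+1 => m bm; rewrite bm.
  - by exists 0%N => n m _ mb; rewrite ltnNge mb.
apply: (point _ _ c00) => // -[[|n] [|m]] // _ ct.
- by case: no0; exists m.
- by case: nospine; exists n.
- by case: noleaf; exists n, m.
Qed.

(** Each member of the family has a separating set of smooth functionals, but
    these sets shrink as [b] grows, and no functional takes part in all of them
    without vanishing on [apex]. *)
Definition fan_diffeology : diffeology R V :=
  union_diffeology (fun=> 0%N) (fun b => weak_diffeology (fan_functional b)).

Lemma fan_vector_diffeology : vector_diffeology fan_diffeology.
Proof.
apply: union_vector_diffeology => [b|b b'].
  by apply: weak_vector_diffeology => l [].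
exists (fun n => maxn (b n) (b' n)) => n U p; case=> -[oU sp]; split=> // l.
  move=> [l1 l2 l3 [N NP]]; apply: sp; split=> //; exists N => k m Nk mb.
  by rewrite NP// leq_max mb.
move=> [l1 l2 l3 [N NP]]; apply: sp; split=> //; exists N => k m Nk mb.
by rewrite NP// leq_max mb orbT.
Qed.

Definition fan : dvs R := Dvs fan_vector_diffeology.

(** Locally a plot is smooth against one separating family
    [fan_functional b]. *)
Lemma fan_FFV : FFV fan.
Proof.
move=> S fdS D vD n U p [oU Up]; apply: plot_local => u /Up [b [W [oW Wu WU [_ sW]]]].
exists W; split=> //; apply: (@separating_subspace_plot _ fan (fan_functional b) S) => //.
- by move=> l [].
- by move=> a l l'; exact: fan_functional_closed.
- by move=> x /(fan_functional_separate b).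
Qed.

Lemma fan_null_sequence b (v : nat -> V) :
    (forall l, fan_functional b l -> exists N, forall n, (N <= n)%N -> l (v n) = 0) ->
  null_sequence fan_diffeology v.
Proof.
move=> bv; have [|k [Dk k0 kv]] := @weak_null_sequence R V (fan_functional b) v _ bv.
  by move=> l [].
by exists k; split=> //; exact: (@union_plot _ _ _ _ b).
Qed.

(** D-open sets [A] around [apex] and [B] around [0] meet: [A] contains
    [leaf n (M n)] for all large [n], and the bound [b := M] makes these tend
    to [0]. *)
Lemma fan_not_HT : ~ HT fan.
Proof.
rewrite /HT open_hausdorff => /(_ apex 0).
have apex0 : apex != 0 :> V.
  apply/eqP => /(congr1 (coef (0, 0)%N)); rewrite coef_basis eqxx linear0.
  by move/eqP; rewrite oner_eq0.
move=> /(_ apex0) [[A B] /= [/set_mem Aa /set_mem B0] [oA oB /eqP AB0]].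
have scal l b (x y : V) : fan_functional b l -> l (x - y) = l x - l y.
  by move=> [linl _ _ _]; rewrite addrC -scaleN1r linl mulN1r addrC.
have [|N NA] := null_sequence_D_open fan_vector_diffeology
    (v := fun n => spine n - apex) _ oA Aa.
  apply: (@fan_null_sequence (fun=> 0%N)) => l lb.
  have [_ [N NP] _ _] := lb; exists N => n /NP; rewrite (scal _ _ _ _ lb) => ->.
  by rewrite subrr.
have spineA n : (N <= n)%N -> A (spine n) by move=> /NA; rewrite addrC subrK.
have leafA n : exists M, (N <= n)%N -> A (leaf n M).
  have [Nn|nN] := leqP N n; last by exists 0%N.
  have [|M MA] := null_sequence_D_open fan_vector_diffeology
      (v := fun m => leaf n m - spine n) _ oA (spineA n Nn).
    apply: (@fan_null_sequence (fun=> 0%N)) => l lb.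
    have [_ _ /(_ n) [M MP] _] := lb; exists M => m /MP.
    by rewrite (scal _ _ _ _ lb) => ->; rewrite subrr.
  by exists M => _; have := MA M (leqnn M); rewrite addrC subrK.
have [M MP] := choice leafA.
have [|N' NB] := null_sequence_D_open fan_vector_diffeology
    (v := fun n => leaf n (M n)) _ oB B0.
  apply: (@fan_null_sequence M) => l [_ _ _ [N' NP]]; exists N' => n N'n.
  exact: NP.
have : (A `&` B) (leaf (maxn N N') (M (maxn N N'))).
  split; first by apply: MP; exact: leq_maxl.
  by have := NB (maxn N N') (leq_maxr _ _); rewrite add0r.
by rewrite AB0.
Qed.

Lemma FFV_not_HT : ~ included (@FFV R) (@HT R).
Proof. by move=> /(_ _ fan_FFV); exact: fan_not_HT. Qed.

End SequentialFan.

(** * Linear lifts *)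

Section LinearLift.
Context {R : realType} (V W1 W2 : lmodType R).
Context (f : {linear W1 -> W2}) (g : {linear V -> W2}).

Definition partial_lift (G : set (V * W1)) :=
  [/\ forall a x y, G x -> G y -> G (a *: x.1 + y.1, a *: x.2 + y.2),
      forall x, G x -> f x.2 = g x.1 &
      forall w, G (0, w) -> w = 0].

(** A maximal graph of a partial linear lift is defined everywhere, for otherwise
    it could be extended by the line through [(v, w)] with [f w = g v]. Graphs
    rather than functions are ordered, so that chains have unions. *)
Lemma linear_lift : (forall y, exists x, f x = y) ->
  exists h : {linear V -> W1}, g =1 f \o h.
Proof.
move=> surj.
have [|A [[Alin Alift A0] Amax]] := @Zorn_bigcup (V * W1)%type partial_lift.
  move=> F FP tot; split.
  - move=> a x y [X FX Xx] [Y FY Yy].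
    have [XY|YX] := tot _ _ FX FY.
      by exists Y => //; have [+ _ _] := FP _ FY; apply=> //; exact: XY.
    by exists X => //; have [+ _ _] := FP _ FX; apply=> //; exact: YX.
  - by move=> x [X FX Xx]; have [_ + _] := FP _ FX; apply.
  - by move=> w [X FX Xw]; have [_ _] := FP _ FX; apply.
(* the empty graph is a partial lift, so [(0, 0)] lies in [A] only by maximality *)
have A00 : A (0, 0).
  apply: contrapT => nA00; apply: (Amax (A `|` [set (0, 0)])).
    split; first by move=> x; left.
    by move=> /(_ (0, 0)) h; apply: nA00; apply: h; right.
  split.
  - move=> a x y [Ax|->] [Ay|->] /=.
    + by left; exact: Alin.
    + rewrite !addr0; have [->|_] := eqVneq a 0; first by rewrite !scale0r; right.
      left; have := Alin (a - 1) _ _ Ax Ax.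
      by rewrite !scalerBl !scale1r !subrK.
    + by rewrite !scaler0 !add0r; left; case: y Ay.
    + by rewrite !scaler0 !add0r; right.
  - by move=> x [/Alift//|->] /=; rewrite !linear0.
  - by move=> w [/A0//|[]].
have AZ a x : A x -> A (a *: x.1, a *: x.2).
  by move=> Ax; have := Alin a _ _ Ax A00; rewrite !addr0.
have dom v : exists w, A (v, w).
  apply: contrapT => nv; have [w fw] := surj (g v).
  pose B := [set x | exists c y, A y /\ x = (c *: v + y.1, c *: w + y.2)].
  apply: (Amax B).
    split.
      move=> x Ax; exists 0, x; rewrite !scale0r !add0r; split=> //; by case: x Ax.
    move=> BA; apply: nv; exists w; apply: BA; exists 1, (0, 0).
    by rewrite !scale1r !addr0.
  split.
  - move=> a _ _ [c [y [Ay ->]]] [c' [y' [Ay' ->]]] /=.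
    exists (a * c + c'), (a *: y.1 + y'.1, a *: y.2 + y'.2); split; first exact: Alin.
    by congr pair; rewrite /= !scalerDr !scalerDl !scalerA addrACA.
  - by move=> _ [c [y [Ay ->]]] /=; rewrite !linearD !linearZ /= fw (Alift _ Ay).
  - move=> w' [c [y [Ay [e ->]]]]; have [c0|c0] := eqVneq c 0.
      move: e; rewrite c0 !scale0r !add0r => y0; apply: A0; rewrite y0.
      by case: y Ay {y0}.
    case: nv; exists (- c^-1 *: y.2).
    have -> : v = - c^-1 *: y.1.
      apply: (scalerI c0); rewrite scalerA mulrN divff// scaleN1r.
      by apply/eqP; rewrite -addr_eq0 -e.
    exact: AZ.
have [h hP] := choice dom.
have uniqA v w w' : A (v, w) -> A (v, w') -> w = w'.
  move=> Aw Aw'; have := Alin (-1) _ _ Aw Aw' => /=.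
  rewrite scaleN1r addNr => /A0 /eqP; rewrite scaleN1r addrC subr_eq0 => /eqP.
  by move=> ->.
have hlin : linear h.
  move=> a v v'; apply: (uniqA (a *: v + v')); first exact: hP.
  exact: (Alin a _ _ (hP v) (hP v')).
pose hL := GRing.isLinear.Build _ _ _ _ h hlin.
pose h' : {linear V -> W1} := HB.pack h hL.
by exists h' => v; rewrite -(Alift _ (hP v)).
Qed.

End LinearLift.

Section FineProjective.
Context {R : realType}.

Lemma subduction_surj X Y (D : diffeology R X) (E : diffeology R Y) f :
  subduction D E f -> forall y, exists x, f x = y.
Proof.
move=> sub y; have /sub [_ /(_ 0 I)] := plot_cst E y (@openT 'rV[R]_0).
move=> [V [_ V0 _ [p _ /(_ _ V0)]]]; by exists (p 0).
Qed.

(** Lifting is a purely algebraic problem here, since every linear map out of a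
    fine space is smooth. *)
Lemma FV_PV : included (@FV R) (@PV R).
Proof.
move=> V fV W1 W2 f g /subduction_surj surj _.
have [h gh] := linear_lift g surj; exists h => //.
apply: fine_linear_smooth => //; last exact: dvs_diffP.
by move=> a x y; rewrite linearP.
Qed.

End FineProjective.

(** * The resolution of a space by its plots *)

Section Resolution.
Context {R : realType} (V : dvs R).

(** All triples [(n, U, p)] are indices and all vectors are points;
    [tautological_plot] selects the actual plots of [V]. *)
Definition plot_index := {n : nat & (set 'rV[R]_n * ('rV[R]_n -> V))%type}.
Definition plot_point := {i : plot_index & 'rV[R]_(tag i)}.
Definition point n (U : set 'rV[R]_n) (p : 'rV[R]_n -> V) (u : 'rV[R]_n) :
  {classic plot_point} := existT _ (existT _ n (U, p)) u.

Definition tautological_plot n (U : set 'rV[R]_n)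
    (q : 'rV[R]_n -> free R {classic plot_point}) : Prop :=
  exists2 p, dvs_diff V n U p & q = fun u => basis (point U p u).

Definition resolution : dvs R :=
  Dvs (@generated_vector_diffeology R _ tautological_plot).

Definition point_value (t : plot_point) : V := (tagged (tag t)).2 (tagged t).

Definition resolution_map : free R {classic plot_point} -> V :=
  free_ext (point_value : {classic plot_point} -> V).

HB.instance Definition _ := GRing.Linear.on resolution_map.

Lemma resolution_map_smooth : smooth (dvs_diff resolution) (dvs_diff V) resolution_map.
Proof.
apply: generated_smooth.
- by move=> a x y; rewrite linearP.
- exact: dvs_diffP.
move=> n U _ oU [p Vp ->]; apply: plot_ext Vp => u _ /=.
by rewrite /resolution_map free_ext_basis.
Qed.

(** A plot of [V] lifts globally, to the tautological plot that it indexes. *)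
Lemma resolution_subduction :
  subduction (dvs_diff resolution) (dvs_diff V) resolution_map.
Proof.
move=> n U q; split=> [Vq|[oU lift]].
  have oU := plot_open Vq; split=> // x Ux; exists U; split=> //.
  exists (fun u => basis (point U q u)).
    by apply: generated_plot => //; exists q.
  by move=> y _; rewrite /resolution_map free_ext_basis.
apply: plot_local => u /lift [W [oW Wu WU [p Dp qp]]]; exists W; split=> //.
by apply: plot_ext (resolution_map_smooth Dp) => x Wx; rewrite qp.
Qed.

(** Coordinates are taken by number, and are [0] beyond the dimension, so that one
    formula gives a smooth function on the domains of all plots at once. *)
Definition nat_coord k n (u : 'rV[R]_n) : R :=
  if insub k is Some j then u 0 j else 0.

Definition pointwise_smooth (phi : {classic plot_point} -> R) :=
  forall n (U : set 'rV[R]_n) p, open U -> smooth_on U (fun u => phi (point U p u)).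

Lemma point_separate (t0 t : {classic plot_point}) : t != t0 ->
  exists2 phi, pointwise_smooth phi & phi t0 != 0 /\ phi t = 0.
Proof.
case: t0 t => [i0 u0] [i u]; have [e|ii0] := pselect (i = i0).
  subst i0 => uu0.
  have /existsP [k uk] : [exists k, u 0 k != u0 0 k].
    apply: contraNT uu0; rewrite negb_exists => /forallP uE.
    apply/eqP; congr existT; apply/rowP => k.
    by have := uE k; rewrite negbK => /eqP.
  exists (fun t : plot_point => nat_coord k (tagged t) - u 0 k).
    move=> n U p oU; rewrite /point /=; apply: (@smooth_onD _ _ _ (nat_coord k (n := n))
      (fun=> - u 0 k)) => //; last exact: smooth_on_cst.
    rewrite /nat_coord; case: insubP => [j _ _|_]; first exact: smooth_on_coord.
    exact: smooth_on_cst.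
  by rewrite /nat_coord /= valK subrr subr_eq0 eq_sym.
move=> _; exists (fun t : plot_point => `[< tag t = i0 >]%:R).
  by move=> n U p oU; rewrite /point /=; exact: smooth_on_cst.
by split; [rewrite asboolT// oner_eq0|rewrite asboolF].
Qed.

(** Functions separating [t0] from one point each are multiplied. *)
Lemma points_separate (t0 : {classic plot_point}) (s : seq {classic plot_point}) :
    t0 \notin s ->
  exists2 phi, pointwise_smooth phi & phi t0 != 0 /\ forall t, t \in s -> phi t = 0.
Proof.
elim: s => [_|t s IH].
  by exists (fun=> 1); [move=> n U p oU; exact: smooth_on_cst|rewrite oner_eq0].
rewrite inE negb_or => /andP[tt0 /IH [phi sphi [phi0 phis]]].
have [|psi spsi [psi0 psit]] := @point_separate t0 t; first by rewrite eq_sym.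
exists (fun t => phi t * psi t).
  by move=> n U p oU; apply: smooth_onM => //; [exact: sphi|exact: spsi].
split; first by rewrite mulf_neq0.
move=> t'; rewrite inE => /orP[/eqP ->|/phis ->]; last by rewrite mul0r.
by rewrite psit mulr0.
Qed.

Lemma resolution_SV : SV resolution.
Proof.
move=> x y xy; have [s [us ss]] := free_supported (x - y).
have [t0 ct0] : exists t0, coef t0 (x - y) != 0.
  apply: contrapT => c0; apply: xy; apply/eqP; rewrite -subr_eq0; apply/eqP.
  apply: coef_eq => t; rewrite linear0; apply/eqP; apply: contrapT => /negP ct.
  by apply: c0; exists t.
have t0s : t0 \in s by apply: contraNT ct0 => /ss ct; rewrite [coef _ _]ct.
have [|phi sphi [phi0 phis]] := @points_separate t0 (rem t0 s).
  by rewrite mem_rem_uniqF.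
exists (free_ext (phi : _ -> R^o)).
  apply: (@generated_smooth _ _ _ R^o) => //.
  - by move=> a v w; rewrite linearP.
  - exact: real_vector_diffeology.
  move=> n U _ oU [p Vp ->]; split=> //.
  by apply: smooth_on_ext (sphi n U p oU) => // u _; rewrite /= free_ext_basis.
suff : free_ext (phi : _ -> R^o) (x - y) != 0 by rewrite linearB subr_eq0 => /eqP.
rewrite (free_extE _ us ss).
rewrite (bigD1_seq t0)//= big_seq_cond big1 ?addr0.
  by rewrite mulf_neq0.
move=> t /andP[ts tt0]; rewrite phis ?scaler0//.
by rewrite mem_rem_uniq// !inE tt0.
Qed.

End Resolution.

Section ProjectiveSeparated.
Context {R : realType}.

Lemma projective_section (V : dvs R) : projective V ->
  exists2 h : {linear V -> resolution V},
    smooth (dvs_diff V) (dvs_diff (resolution V)) h &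
    forall x, resolution_map (h x) = x.
Proof.
move=> pV; have [h sh idh] := pV (resolution V) V (@resolution_map R V) idfun
  (@resolution_subduction R V) (@smooth_id_dvs R V).
by exists h => // x; exact: esym (idh x).
Qed.

(** A smooth linear section of [resolution_map] embeds [V] in a space whose
    smooth linear functionals separate points. *)
Lemma PV_SV : included (@PV R) (@SV R).
Proof.
move=> V /projective_section [h sh hK] x y xy.
have [|l sl lxy] := @resolution_SV R V (h x) (h y).
  by move=> hxy; apply: xy; rewrite -(hK x) hxy hK.
exists (l \o h) => // n U p Vp.
exact: sl _ _ _ (sh _ _ _ Vp).
Qed.

End ProjectiveSeparated.

(** * The space of sequences is not projective *)

Section Length.
Context {R : realType} (T : choiceType).

Definition short m (w : free R T) := exists s, (size s <= m)%N /\ supported s (val w).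

Lemma short_le m m' w : (m <= m')%N -> short m w -> short m' w.
Proof. by move=> mm' [s [sm ss]]; exists s; split=> //; exact: leq_trans mm'. Qed.

(** The tautological plots have length [1], so this vector space diffeology
    contains that of every [resolution]. *)
Program Definition length_diffeology : diffeology R (free R T) :=
  {| plot n U p := open U /\
       forall u, U u -> exists m, \forall v \near u, short m (p v) |}.
Next Obligation. by move=> n U p []. Qed.
Next Obligation.
move=> n U p q pq [oU Up]; split=> // u Uu; have [m pm] := Up u Uu; exists m.
near=> v; rewrite -pq; first by near: v.
by near: v; exact: open_nbhs_nbhs.
Unshelve. all: by end_near. Qed.
Next Obligation.
move=> n U a oU; split=> // u Uu; have [s [_ ss]] := free_supported a.
by exists (size s); near=> v; exists s.
Unshelve. all: by end_near. Qed.
Next Obligation.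
move=> n m U V p g [oU Up] oV sg gVU; split=> // v Vv.
have [k pk] := Up _ (gVU _ Vv); exists k.
exact: (smooth_on_continuous sg Vv pk).
Qed.
Next Obligation.
move=> n F p Fp; split; first by apply: bigcup_open => U /Fp [].
by move=> u [U FU Uu]; have [_] := Fp U FU; exact.
Qed.

Lemma length_vector_diffeology : vector_diffeology length_diffeology.
Proof.
split=> n U p [[oU p1] [_ p2]]; split=> // u Uu; have [m pm] := p2 u Uu.
  have [m' pm'] := p1 u Uu; exists (m' + m)%N.
  near=> v; have [s' [s'm' ss']] : short m' (p v).1 by near: v.
  have [s [sm ss]] : short m (p v).2 by near: v.
  exists (s' ++ s).
  rewrite size_cat leq_add//; split=> // t; rewrite mem_cat negb_or => /andP[ts' ts].
  rewrite -[LHS]/(coef t ((p v).1 + (p v).2)) linearD /=.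
  by rewrite [coef t _]ss'// [coef t _]ss// addr0.
exists m; near=> v; have [s [sm ss]] : short m (p v).2 by near: v.
exists s; split=> // t ts.
by rewrite -[LHS]/(coef t ((p v).1 *: (p v).2)) linearZ /= [coef t _]ss// mulr0.
Unshelve. all: by end_near. Qed.

End Length.

Section Fresh.
Context {R : realType}.

Lemma exists_notin (s : seq R) : exists a, a \notin s.
Proof.
suff [b bP] : exists b, forall x, x \in s -> x < b.
  by exists b; apply/negP => /bP; rewrite ltxx.
elim: s => [|x s [b bP]]; first by exists 0.
exists (Num.max (x + 1) b) => y; rewrite inE => /orP[/eqP ->|/bP yb].
  by rewrite lt_max ltrDl ltr01.
by rewrite lt_max yb orbT.
Qed.

End Fresh.

(** A generic combination of a vector of maximal length with any other vector has
    the union of their supports as its support, so this union cannot be larger. *)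
Lemma bounded_length_support (R : realType) (T : choiceType)
    (Q : set (free R T)) (m : nat) :
    (forall a v w, Q v -> Q w -> Q (a *: v + w)) ->
    (forall w, Q w -> short m w) ->
  exists s, forall w, Q w -> supported s (val w).
Proof.
move=> linQ; elim: m => [|m IH] Qm.
  exists [::] => w /Qm [s [+ ss]]; rewrite leqn0 => /nilP sE.
  by rewrite -sE.
have [/IH//|] := pselect (forall w, Q w -> short m w).
move=> /existsNP [v /not_implyP [Qv vm]].
have [s0 [s0m ss0]] := Qm v Qv.
pose s := [seq t <- undup s0 | coef t v != 0].
have us : uniq s by rewrite filter_uniq// undup_uniq.
have sv t : t \in s = (coef t v != 0).
  rewrite mem_filter mem_undup; have [ct|//] := boolP (coef t v != 0).
  by apply: contraNT ct => /ss0 ct; rewrite [coef t v]ct.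
have ms : (m < size s)%N.
  rewrite ltnNge; apply/negP => sm; apply: vm; exists s; split=> // t.
  by rewrite sv negbK => /eqP.
exists s => w Qw t ts; apply: contrapT => /eqP ct.
(* [a *: v + w] has no zero coefficient on [s], and a nonzero one at [t] *)
have [a] := exists_notin [seq - coef t w / coef t v | t <- s].
move=> /negP na; have Qavw := linQ a v w Qv Qw.
have [s' [s'm ss']] := Qm _ Qavw.
have : (size (t :: s) <= size s')%N.
  apply: uniq_leq_size; first by rewrite /= ts us.
  move=> t' t't; apply: contraT => /ss' /eqP.
  rewrite -[X in X == _]/(coef t' (a *: v + w)) linearP /=.
  move: t't; rewrite inE => /orP[/eqP ->|t's].
    have /eqP -> : coef t v == 0 by apply: contraNT ts; rewrite sv.
    by rewrite mulr0 add0r; move/negP: ct.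
  move=> /eqP e; case: na; apply/mapP; exists t' => //.
  have ct' : coef t' v != 0 by rewrite -sv.
  by apply: (mulIf ct'); rewrite divfK//; apply/eqP; rewrite -addr_eq0 e.
by rewrite /= => /leq_trans/(_ s'm); rewrite ltnS leqNgt ms.
Qed.

Section Sequences.
Context {R : realType}.

Local Notation seqspace := (nat -> R^o).

Definition coordinates : set (seqspace -> R) :=
  [set l | exists k, l = fun x => x k].

Lemma coordinates_scalar l : coordinates l -> scalar l.
Proof. by move=> [k ->] a x y. Qed.

Definition sequences : dvs R :=
  Dvs (weak_vector_diffeology coordinates_scalar).

Lemma sequences_SV : SV sequences.
Proof.
move=> x y xy; have [k xyk] : exists k, x k <> y k.
  by apply: contrapT => /forallNP h; apply: xy; apply/funext => k; exact: contrapT.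
have lk : scalar (fun x : seqspace => x k) by apply: coordinates_scalar; exists k.
pose ll := GRing.isLinear.Build R seqspace R *%R (fun x : seqspace => x k) lk.
pose l : {scalar seqspace} := HB.pack (fun x : seqspace => x k) ll.
by exists l => // n U p [oU sp]; split=> //; apply: sp; exists k.
Qed.

Definition unit_seq (k : nat) : seqspace := fun j => (j == k)%:R.

(** A smooth linear section of the resolution sends some tail to vectors of
    bounded length: otherwise there are sequences [v N] in [tail N] whose images
    have length more than [N], yet [v] is a null sequence, so its image lies on a
    curve whose length is bounded near [0]. Bounded length leaves only finitely
    many dimensions, too few for an injection. *)
Lemma sequences_not_PV : ~ PV sequences.
Proof.
move=> /projective_section [h sh hK].
pose tail N := [set x : seqspace | forall k, (k < N)%N -> x k = 0].
have res_short n (U : set 'rV[R]_n) p : dvs_diff (resolution sequences) n U p ->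
    length_diffeology _ n U p.
  apply: generated_min; first exact: length_vector_diffeology.
  move=> k A q oA [p' _ ->]; split=> // u _; exists 1%N; near=> v.
  exists [:: point A p' v]; split=> // t; rewrite inE => /negbTE tE.
  by rewrite -[LHS]/(coef _ (basis _)) coef_basis tE.
have [N [m hm]] : exists N m, forall x, tail N x -> short m (h x).
  apply: contrapT => nb.
  have /choice [v vP] : forall N, exists x, tail N x /\ ~ short N (h x).
    move=> N; apply: contrapT => /forallNP nx; apply: nb; exists N, N => x Nx.
    by apply: contrapT => sx; exact: (nx x).
  have [||k [kD k0 kv]] := @weak_null_sequence R _ coordinates v.
  - exact: coordinates_scalar.
  - by move=> _ [i ->]; exists i.+1 => n ni; exact: (vP n).1.
  have [_ /(_ 0 I) [m km]] := res_short _ _ _ (sh _ _ _ kD).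
  have [M MP] := dyadic_near0 km.
  apply: (vP (maxn M m)).2; apply: short_le (leq_maxr M m) _.
  by rewrite -kv; exact: MP (leq_maxl _ _).
have [||s ss] := @bounded_length_support R _ (h @` tail N) m.
- move=> a _ _ [x Nx <-] [y Ny <-]; exists (a *: x + y); last by rewrite linearP.
  by move=> k kN; rewrite !fctE Nx// Ny// scaler0 addr0.
- by move=> _ [x /hm hx <-].
pose d := size s.
pose A : 'M[R]_(d.+1, d) := \matrix_(i, j) coef (tnth (in_tuple s) j) (h (unit_seq (N + i))).
(* [d.+1] vectors of the tail have images in a space of dimension [d] *)
have : kermx A != 0.
  rewrite kermx_eq0 -row_leq_rank -ltnNge.
  by apply: leq_ltn_trans (rank_leq_col A) _.
move=> /rowV0Pn [a /sub_kermxP aA a0].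
pose x := \sum_(i < d.+1) a 0 i *: unit_seq (N + i).
have Nx : tail N x.
  move=> k kN; rewrite /x fct_sumE big1// => i _.
  by rewrite fctE /unit_seq ltn_eqF ?scaler0// ltn_addr.
have hx0 : h x = 0.
  apply: coef_eq => t; rewrite [RHS]linear0.
  have [/tnthP [j tj]|ts] := boolP (t \in in_tuple s); last first.
    by rewrite [LHS](ss (h x))//; exists x.
  have /matrixP/(_ 0 j) := aA; rewrite !mxE => <-.
  rewrite /x !linear_sum /=; apply: eq_bigr => i _.
  by rewrite !linearZ /= mxE tj.
have x0 : x = 0 by rewrite -[x]hK hx0 linear0.
case/eqP: a0; apply/rowP => i; rewrite mxE.
have := congr1 (fun y => y (N + i)%N) x0; rewrite /x fct_sumE (bigD1 i)//= big1 => [|j ji].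
  by rewrite addr0 fctE /unit_seq eqxx /GRing.scale/= mulr1.
rewrite fctE /unit_seq (_ : (N + i == N + j)%N = false) ?scaler0//.
by rewrite eqn_add2l eq_sym; exact: negbTE.
Unshelve. all: by end_near. Qed.

Lemma SV_not_PV : ~ included (@SV R) (@PV R).
Proof. by move=> /(_ _ sequences_SV); exact: sequences_not_PV. Qed.

End Sequences.

(** * The free space on the line *)

Section GlobalLift.
Context {R : realType} {W1 : lmodType R} {X : Type}.
Context (D : diffeology R W1) (vD : vector_diffeology D) (f : W1 -> X)
  (q : 'rV[R]_1 -> X).
(* the lifts of one point form an affine subspace *)
Hypothesis f_convex : forall (a : R) x y z, f x = z -> f y = z ->
  f ((1 - a) *: x + a *: y) = z.

Definition lifts (U : set 'rV[R]_1) p := D 1%N U p /\ forall u, U u -> q u = f (p u).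

Definition lifts_near (a b : R) := exists U p,
  lifts U p /\ forall u : 'rV[R]_1, a <= u 0 0 -> u 0 0 <= b -> U u.

Definition strip (a b : R) : set 'rV[R]_1 :=
  [set u : 'rV[R]_1 | a < u 0 0 /\ u 0 0 < b].

Lemma open_strip a b : open (strip a b).
Proof.
have c : continuous (fun u : 'rV[R]_1 => u 0 0) by exact: coord_continuous.
rewrite (_ : strip a b = (fun u : 'rV[R]_1 => u 0 0) @^-1` [set t | a < t] `&`
  (fun u : 'rV[R]_1 => u 0 0) @^-1` [set t | t < b]) //.
by apply: openI; apply: open_comp => // *; exact: c.
Qed.

Lemma nbhs_strip (U : set 'rV[R]_1) (u : 'rV[R]_1) : open U -> U u ->
  exists2 e, 0 < e & strip (u 0 0 - e) (u 0 0 + e) `<=` U.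
Proof.
move=> oU Uu.
have /nbhs_ballP [e /= e0 eU] : nbhs u U by exact: open_nbhs_nbhs.
exists e => // v [v1 v2]; apply: eU; split=> // i j; rewrite !ord1 /ball /=.
by rewrite ltr_distlC; apply/andP; split; lra.
Qed.

Lemma lifts_sub U V p : open V -> V `<=` U -> lifts U p -> lifts V p.
Proof.
move=> oV VU [Dp fp]; split; first exact: plot_sub Dp.
by move=> u /VU; exact: fp.
Qed.

Lemma lifts_ext U p p' : (forall u, U u -> p u = p' u) -> lifts U p -> lifts U p'.
Proof.
move=> pp' [Dp fp]; split; first exact: plot_ext Dp.
by move=> u Uu; rewrite fp// pp'.
Qed.

Lemma lifts_local U p :
  (forall u, U u -> exists V, [/\ open V, V u, V `<=` U & lifts V p]) -> lifts U p.
Proof.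
move=> H; split; last by move=> u /H [V [_ Vu _ [_]]]; exact.
by apply: plot_local => u /H [V [oV Vu VU [DV _]]]; exists V.
Qed.

Lemma lifts_convex U (s : R -> R) p1 p2 :
  smooth_on setT (fun u : 'rV[R]_1 => s (u 0 0)) -> lifts U p1 -> lifts U p2 ->
  lifts U (fun u : 'rV[R]_1 => (1 - s (u 0 0)) *: p1 u + s (u 0 0) *: p2 u).
Proof.
move=> ss [D1 f1] [D2 f2]; have oU := plot_open D1.
have sU : smooth_on U (fun u : 'rV[R]_1 => s (u 0 0)) by exact: smooth_on_sub ss.
split; last by move=> u Uu; apply/esym/f_convex; [rewrite -f1|rewrite -f2].
apply: plotD => //; apply: plotZ => //.
apply: (@smooth_on_ext _ _ _ _ (fun u => 1 + -1 * s (u 0 0))) => //.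
  by move=> u _; rewrite mulN1r.
apply: smooth_onD => //; first exact: smooth_on_cst.
by apply: smooth_onM => //; exact: smooth_on_cst.
Qed.

Lemma lifts_near_sub a b a' b' :
  a <= a' -> b' <= b -> lifts_near a b -> lifts_near a' b'.
Proof.
move=> aa bb [U [p [lp abU]]]; exists U, p; split=> // u au ub.
by apply: abU; lra.
Qed.

(** Two lifts over a neighbourhood of [b] are interpolated there by a smooth
    step function, which is legitimate because [f] is linear. *)
Lemma lifts_near_glue a b c : a <= b -> b <= c ->
  lifts_near a b -> lifts_near b c -> lifts_near a c.
Proof.
move=> ab bc [U1 [p1 [l1 U1P]]] [U2 [p2 [l2 U2P]]].
have oU1 := plot_open l1.1; have oU2 := plot_open l2.1.
have [||e e0 eU] := @nbhs_strip (U1 `&` U2) (const_mx b).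
- exact: openI.
- by split; [apply: U1P|apply: U2P]; rewrite mxE.
rewrite mxE in eU.
have [|s ss [s0 s1]] := @smooth_step R (b - e / 2) (b + e / 2); first lra.
pose p (u : 'rV[R]_1) := (1 - s (u 0 0)) *: p1 u + s (u 0 0) *: p2 u.
pose U (u : 'rV[R]_1) := [\/ U1 u /\ u 0 0 < b - e / 2, strip (b - e) (b + e) u |
                U2 u /\ b + e / 2 < u 0 0].
exists U, p; split; last first.
  move=> u au uc; rewrite /U.
  have [h1|h1] := ltP (u 0 0) (b - e / 2).
    by apply: Or31; split=> //; apply: U1P => //; lra.
  have [h2|h2] := ltP (b + e / 2) (u 0 0).
    by apply: Or33; split=> //; apply: U2P => //; lra.
  by apply: Or32; split; lra.
apply: lifts_local => u Uu; case: (Uu) => [[U1u ub]|su|[U2u ub]].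
- exists (U1 `&` strip (u 0 0 - 1) (b - e / 2)).
  have oV := openI oU1 (@open_strip (u 0 0 - 1) (b - e / 2)).
  split=> //; first by split=> //; split=> //; lra.
    by move=> v [U1v [_ vb]]; apply: Or31.
  apply: (@lifts_ext _ p1); last by apply: lifts_sub l1 => // v [].
  move=> v [_ [_ vb]]; rewrite /p s0; last lra.
  by rewrite subr0 scale1r scale0r addr0.
- exists (strip (b - e) (b + e)); have oV := @open_strip (b - e) (b + e).
  split=> //; first by move=> v sv; apply: Or32.
  apply: lifts_convex => //; [apply: lifts_sub l1 => //|apply: lifts_sub l2 => //].
    by move=> v /eU [].
  by move=> v /eU [].
- exists (U2 `&` strip (b + e / 2) (u 0 0 + 1)).
  have oV := openI oU2 (@open_strip (b + e / 2) (u 0 0 + 1)).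
  split=> //; first by split=> //; split=> //; lra.
    by move=> v [U2v [vb _]]; apply: Or33.
  apply: (@lifts_ext _ p2); last by apply: lifts_sub l2 => // v [].
  move=> v [_ [vb _]]; rewrite /p s1; last lra.
  by rewrite subrr scale0r scale1r add0r.
Qed.

Hypothesis local_lifts : forall u, exists U p, [/\ open U, U u & lifts U p].

Lemma lifts_near_point t : exists2 e, 0 < e & lifts_near (t - e) (t + e).
Proof.
have [U [p [oU Ut lp]]] := local_lifts (const_mx t).
have [e e0] := nbhs_strip oU Ut; rewrite mxE => eU.
exists (e / 2); first by rewrite divr_gt0.
by exists U, p; split=> // u u1 u2; apply: eU; split; lra.
Qed.

(** The supremum of the end points that can be reached by gluing cannot lie
    before [b]. *)
Lemma lifts_near_segment a b : a <= b -> lifts_near a b.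
Proof.
move=> ab; apply: contrapT => nab.
pose S := [set c | a <= c /\ lifts_near a c].
have Sa : S a.
  split=> //; have [e e0] := lifts_near_point a.
  by apply: lifts_near_sub; lra.
have Sb : ubound S b.
  move=> c [ac lac]; have [//|/ltW bc] := leP c b.
  by case: nab; apply: lifts_near_sub lac.
have hS : has_sup S by split; [exists a|exists b].
have [e e0 le] := lifts_near_point (sup S).
have [c [ac lac] cS] := sup_adherent e0 hS.
have cs : c <= sup S by apply: sup_upper_bound => //; split.
have : S (sup S + e).
  split; first lra.
  apply: (@lifts_near_glue a c) => //; first lra.
  by apply: lifts_near_sub le; lra.
by move=> /(sup_upper_bound hS); rewrite leNgt ltrDl e0.
Qed.

(** Lifts over the segments of length [2] centred at the integers are patched:
    between [k] and [k + 1] one passes from the [k]-th to the next by a step that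
    is constant near both ends, so that the [k]-th lift alone is used near [k]. *)
Lemma global_lift : exists p, lifts setT p.
Proof.
have /choice [p] : forall k : int, exists p, lifts (strip (k%:~R - 1) (k%:~R + 1)) p.
  move=> k; have [|U [p [lp UP]]] := @lifts_near_segment (k%:~R - 1) (k%:~R + 1).
    lra.
  exists p; apply: lifts_sub lp; first exact: open_strip.
  by move=> u [u1 u2]; apply: UP; exact: ltW.
move=> lp.
have /choice [s] : forall k : int, exists s : R -> R,
    smooth_on setT (fun u : 'rV[R]_1 => s (u 0 0)) /\
    ((forall x, x <= k%:~R + 1 / 4 -> s x = 0) /\
     (forall x, k%:~R + 3 / 4 <= x -> s x = 1)).
  move=> k; have [|s ss sP] := @smooth_step R (k%:~R + 1 / 4) (k%:~R + 3 / 4).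
    lra.
  by exists s.
move=> sP.
pose P k (u : 'rV[R]_1) := (1 - s k (u 0 0)) *: p k u + s k (u 0 0) *: p (k + 1) u.
exists (fun u : 'rV[R]_1 => P (Num.floor (u 0 0)) u); apply: lifts_local => u _.
have := floor_itv (u 0 0); set k := Num.floor (u 0 0).
rewrite intrD => /andP[]; rewrite le_eqVlt => /orP[/eqP ku _|ku uk].
  have oV := @open_strip (k%:~R - 1 / 4) (k%:~R + 1 / 4) : open _.
  exists (strip (k%:~R - 1 / 4) (k%:~R + 1 / 4)); split=> //; first by split; lra.
  apply: (@lifts_ext _ (p k)); last first.
    by apply: lifts_sub (lp k) => // v [v1 v2]; split; lra.
  move=> v [v1 v2]; have [kv|vk] := leP k%:~R (v 0 0).
    have -> : Num.floor (v 0 0) = k.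
      by apply: floor_def; rewrite kv intrD; lra.
    rewrite /P (sP k).2.1; last lra.
    by rewrite subr0 scale1r scale0r addr0.
  have -> : Num.floor (v 0 0) = k - 1.
    by apply: floor_def; rewrite subrK vk intrB; lra.
  rewrite /P (sP (k - 1)).2.2; last by rewrite intrB; lra.
  by rewrite subrr scale0r scale1r add0r subrK.
have oV := @open_strip k%:~R (k%:~R + 1) : open _.
exists (strip k%:~R (k%:~R + 1)); split=> //.
apply: (@lifts_ext _ (P k)).
  move=> v [v1 v2]; congr P; apply/esym/floor_def.
  by rewrite ltW// intrD.
apply: lifts_convex; first exact: (sP k).1.
  by apply: lifts_sub (lp k) => // v [v1 v2]; split; lra.
by apply: lifts_sub (lp (k + 1)) => // v [v1 v2]; rewrite intrD; split; lra.
Qed.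

End GlobalLift.

Section FreeLine.
Context {R : realType}.

Local Notation V := (free R 'rV[R]_1).

Definition line_plot n (U : set 'rV[R]_n) (q : 'rV[R]_n -> V) : Prop :=
  exists2 g : 'rV[R]_n -> 'rV[R]_1, smooth_on U g & q = basis \o g.

Definition free_line : dvs R := Dvs (@generated_vector_diffeology R V line_plot).

Lemma free_line_basis_plot : dvs_diff free_line 1%N setT basis.
Proof.
apply: generated_plot; first exact: openT.
by exists id => //; apply: smooth_on_components => [|j]; [exact: openT|
  exact: smooth_on_coord openT].
Qed.

(** A smooth linear map out of [free_line] amounts to a plot over the whole line,
    and these lift through subductions by [global_lift]. *)
Lemma free_line_PV : PV free_line.
Proof.
move=> W1 W2 f g sub sg.
pose q (u : 'rV[R]_1) := g (basis u).
have [||p [Dp fp]] := @global_lift R W1 W2 (dvs_diff W1) (dvs_diffP W1) f q.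
- move=> a x y z fx fy.
  by rewrite linearD !linearZ /= fx fy -scalerDl subrK scale1r.
- have /sub [_ ql] := sg _ _ _ free_line_basis_plot.
  move=> u; have [U [oU Uu _ [p Dp qp]]] := ql u I; exists U, p.
  by split=> //; split.
exists (free_ext p : {linear V -> W1}).
  apply: generated_smooth; first by move=> a x y; rewrite linearP.
    exact: dvs_diffP.
  move=> n U _ oU [h sh ->].
  have := plot_comp Dp oU sh (fun _ _ => I).
  by apply: plot_ext => u _; rewrite /= free_ext_basis.
apply: (@free_linear_eq R 'rV[R]_1 W2 g (f \o free_ext p)) => u.
by rewrite /= free_ext_basis -fp.
Qed.

(** On a fine space every linear functional would be smooth, but the values of a
    functional on the basis vectors are arbitrary, for instance [`|u 0 0|]. *)
Lemma free_line_not_FV : ~ FV free_line.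
Proof.
move=> fineV; apply: (@norm_not_smooth R).
pose l : V -> R^o := free_ext (fun u : 'rV[R]_1 => `|u 0 0| : R^o).
have sl : scalar l by move=> a x y; rewrite /l linearP.
have [_] := fine_scalar_smooth fineV sl free_line_basis_plot.
apply: smooth_on_ext; first exact: openT.
by move=> u _; rewrite /= /l free_ext_basis.
Qed.

Lemma PV_not_FV : ~ included (@PV R) (@FV R).
Proof. by move=> /(_ _ free_line_PV); exact: free_line_not_FV. Qed.

End FreeLine.

(** * Comparison of the collections *)

Theorem theorem1p1 (R : realType) :
  strictly_included (@FV R) (@PV R) /\
  strictly_included (@PV R) (@SV R) /\
  included (@SV R) (@SD R) /\
  strictly_included (@SD R) (@FFV R) /\
  strictly_included (@SD R) (@HT R) /\
  ~ included (@HT R) (@FFV R) /\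
  ~ included (@FFV R) (@HT R).
Proof.
split; first by split; [exact: FV_PV|exact: PV_not_FV].
split; first by split; [exact: PV_SV|exact: SV_not_PV].
split; first exact: SV_SD.
split.
  split; [exact: SD_FFV|move=> FFV_SD; apply: (@FFV_not_HT R) => V /FFV_SD].
  exact: SD_HT.
split.
  split; [exact: SD_HT|move=> HT_SD; apply: (@HT_not_FFV R) => V /HT_SD].
  exact: SD_FFV.
by split; [exact: HT_not_FFV|exact: FFV_not_HT].
Qed.
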